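(* Let $0<d_1<\cdots<d_k<n$ be integers and let $\mathbf{M}=(M_1,\dots,M_k)\in\mathcal{M}^{d_1,\dots,d_k}_n$ be a plurimatroid. Then the universal geometric quotient of the thin Schubert cell $\mathbb{F}_{\mathbf{M}}$ by $T_{\mathbf{M}}$, denoted by $\mathcal{F}_{\mathbf{M}}$, exists and is affine, and the morphism $\pi:\mathbb{F}_{\mathbf{M}}\to\mathcal{F}_{\mathbf{M}}$, $\mathbf{\Lambda}\mapsto\mathbf{\Lambda}\cdot T_{\mathbf{M}}$ (sending a point to its orbit), is universally submersive; in particular, $\mathcal{F}_{\mathbf{M}}$ is a universal categorical quotient.
   Context: $[n]=\{1,\dots,n\}$ and $\binom{[n]}{d}$ is the set of $d$-element subsets of $[n]$. A matroid of rank $d$ on $n$ elements is a pair $M=([n],\mathcal{B})$ with $\emptyset\neq\mathcal{B}\subset\binom{[n]}{d}$ such that for all $I,J\in\mathcal{B}$ and $i\in I\setminus J$ there is $j\in J\setminus I$ with $(I\setminus\{i\})\cup\{j\}\in\mathcal{B}$; the elements of $\mathcal{B}$ are its bases. $\mathcal{M}^d_n$ is the set of such matroids, and $\mathcal{M}^{d_1,\dots,d_k}_n=\mathcal{M}^{d_1}_n\times\cdots\times\mathcal{M}^{d_k}_n$; its elements are called plurimatroids. $G(d,n)$ is the Grassmannian of $d$-dimensional subspaces of $\mathbb{C}^n$ (row vectors; a subspace is the row space of a $d\times n$ matrix), with Plücker coordinates $(p_I)_{I\in\binom{[n]}{d}}$. For $M=([n],\mathcal{B})\in\mathcal{M}^d_n$,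 $G_M=\{W\in G(d,n): p_I(W)\neq0\Leftrightarrow I\in\mathcal{B}\}$. The flag variety is $\mathbb{F}_{d_1<\cdots<d_k}(\mathbb{C}^n)=\{W_1\subset\cdots\subset W_k\subset\mathbb{C}^n:\dim W_i=d_i\}\subset\prod_{i}G(d_i,n)$. The thin Schubert cell of $\mathbf{M}$ is $\mathbb{F}_{\mathbf{M}}=\left(\prod_{i=1}^kG_{M_i}\right)\cap\mathbb{F}_{d_1<\cdots<d_k}(\mathbb{C}^n)$, which is affine and locally closed in the flag variety. $T<\mathrm{GL}_n(\mathbb{C})$ is the torus of invertible diagonal matrices, acting on the right by $(W_1,\dots,W_k)\cdot g=(W_1g,\dots,W_kg)$; $\mathbb{F}_{\mathbf{M}}$ is $T$-invariant, and any two points of $\mathbb{F}_{\mathbf{M}}$ have the same isotropy group, denoted $\mathrm{Stab}_T(\mathbb{F}_{\mathbf{M}})$. Put $T_{\mathbf{M}}=T/\mathrm{Stab}_T(\mathbb{F}_{\mathbf{M}})$, a torus acting on $\mathbb{F}_{\mathbf{M}}$ by $\mathbf{\Lambda}\cdot[g]=\mathbf{\Lambda}\cdot g$. ''Universal geometric quotient'', ''universal categorical quotient'' and ''universally submersive'' are in the sense of Mumford's Geometric Invariant Theory (''universal'' meaning that the property is preserved under arbitrary base change of the quotient). *)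

(* Defs.v *)
From HB Require Import structures.
From mathcomp Require Import all_boot all_order all_algebra.
From mathcomp Require Import boolp classical_sets reals complex.
From mathcomp Require Import mpoly.

Set Implicit Arguments.
Unset Strict Implicit.
Unset Printing Implicit Defensive.

Import Order.TTheory GRing.Theory Num.Theory.
#[local] Obligation Tactic := idtac.
Local Open Scope classical_set_scope.
Local Open Scope ring_scope.

(* Schemes are treated by their functors of points (Demazure-Gabriel): a      *)
(* scheme over k is a functor from commutative k-algebras to sets that is a   *)
(* sheaf for the Zariski topology and is covered by open affine subfunctors.  *)
(* The structures comAlgType and algType of MathComp only contain nonzero     *)
(* rings, but the zero ring is needed (it is the coordinate ring of the empty *)
(* scheme), hence the following bundled k-algebras.                           *)

Section Schemes.
Variable k : comPzRingType.

Record kalg := KAlg {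
  kalg_ring :> comPzRingType;
  kalg_str : {rmorphism k -> kalg_ring} }.

Record khom (A B : kalg) := KHom {
  khom_fun :> {rmorphism A -> B};
  khom_str : forall c, khom_fun (kalg_str A c) = kalg_str B c }.

Lemma khom_eq (A B : kalg) (f g : khom A B) : f =1 g -> f = g.
Proof.
case: f g => [[f [[bf] [mf]]] pf] [[g [[bg] [mg]]] pg] /= /funext e.
subst g.
rewrite (Prop_irrelevance bf bg) (Prop_irrelevance mf mg) in pf *.
by rewrite (Prop_irrelevance pf pg).
Qed.

Definition kcomp (A B D : kalg) (g : khom B D) (f : khom A B) : khom A D :=
  @KHom A D (g \o f)
    (fun c => etrans (congr1 g (khom_str f c)) (khom_str g c)).

Definition is_field (A : kalg) : Prop :=
  (1 : A) <> 0 /\ forall x : A, x <> 0 -> exists y, x * y = 1.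

(* B is the localization A_s of A at the powers of s. *)
Definition is_localization (A B : kalg) (f : khom A B) (s : A) : Prop :=
  [/\ exists y, f s * y = 1,
      forall b : B, exists a (m : nat), b * f s ^+ m = f a
    & forall a : A, f a = 0 -> exists m : nat, s ^+ m * a = 0].

Definition unit_ideal (A : kalg) (E : set A) : Prop :=
  exists (m : nat) (b e : 'I_m -> A),
    (forall i, E (e i)) /\ \sum_(i < m) b i * e i = 1.

Record kfunctor := KFunctor {
  points :> kalg -> Type;
  fmap : forall A B, khom A B -> points A -> points B;
  fmap_id : forall A (f : khom A A) x, f =1 id -> fmap f x = x;
  fmap_comp : forall A B D (f : khom A B) (g : khom B D) (h : khom A D) x,
    h =1 g \o f -> fmap h x = fmap g (fmap f x) }.

Record kmor (X Y : kfunctor) := KMor {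
  kmor_fun :> forall A, X A -> Y A;
  kmor_nat : forall A B (f : khom A B) x,
    kmor_fun (fmap f x) = fmap f (kmor_fun x) }.

Definition is_iso (X Y : kfunctor) (f : kmor X Y) : Prop :=
  exists g : kmor Y X, (forall A (x : X A), g A (f A x) = x) /\
                       (forall A (y : Y A), f A (g A y) = y).

Program Definition Spec (A : kalg) : kfunctor :=
  @KFunctor (khom A) (fun B D g f => kcomp g f) _ _.
Next Obligation. by move=> A B f x e; apply: khom_eq => a /=; rewrite e. Qed.
Next Obligation.
by move=> A B D E f g h x e; apply: khom_eq => a /=; rewrite e.
Qed.

Program Definition affine_line : kfunctor :=
  @KFunctor (fun A => A) (fun A B f x => f x) _ _.
Next Obligation. by move=> A f x e; exact: e. Qed.
Next Obligation. by move=> A B D f g h x e; exact: e. Qed.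

Definition is_affine (X : kfunctor) : Prop :=
  exists (A : kalg) (f : kmor X (Spec A)), is_iso f.

Record subfunctor (X : kfunctor) := SubFunctor {
  sub_mem :> forall A, set (X A);
  sub_fmap : forall A B (f : khom A B) x, sub_mem x -> sub_mem (fmap f x) }.

Lemma sig_eq (T : Type) (P : T -> Prop) (u v : {x | P x}) :
  sval u = sval v -> u = v.
Proof.
by case: u v => [u pu] [v pv] /= e; subst v; rewrite (Prop_irrelevance pu pv).
Qed.

Program Definition sub_functor (X : kfunctor) (U : subfunctor X) : kfunctor :=
  @KFunctor (fun A => {x : X A | U A x})
    (fun A B f x => exist _ (fmap f (sval x)) (sub_fmap f (svalP x))) _ _.
Next Obligation. by move=> X U A f x e; apply: sig_eq; rewrite /= fmap_id. Qed.
Next Obligation.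
by move=> X U A B D f g h x e; apply: sig_eq; rewrite /= (fmap_comp _ e).
Qed.

Program Definition preimage_sub (X Y : kfunctor) (f : kmor X Y)
    (U : subfunctor Y) : subfunctor X :=
  @SubFunctor X (fun A => [set x | U A (f A x)]) _.
Next Obligation.
by move=> X Y f U A B h x Ux; rewrite /= kmor_nat; exact: sub_fmap.
Qed.

(* The pullback of U along every Spec A -> X is the open subset of Spec A     *)
(* where the ideal generated by some E does not vanish.                       *)
Definition is_open (X : kfunctor) (U : subfunctor X) : Prop :=
  forall A (x : X A), exists E : set A,
    forall B (f : khom A B), U B (fmap f x) <-> unit_ideal (f @` E).

(* The Zariski sheaf condition. Agreement of sections on A_(s_i s_j) is       *)
(* agreement in every algebra that receives both A_(s_i) and A_(s_j).         *)
Definition is_sheaf (X : kfunctor) : Prop :=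
  forall (A : kalg) (m : nat) (s : 'I_m -> A) (B : 'I_m -> kalg)
         (f : forall i, khom A (B i)),
    unit_ideal (range s) -> (forall i, is_localization (f i) (s i)) ->
  forall x : forall i, X (B i),
    (forall i j D (g : khom (B i) D) (h : khom (B j) D),
        g \o f i =1 h \o f j -> fmap g (x i) = fmap h (x j)) ->
  exists! y : X A, forall i, fmap (f i) y = x i.

Definition is_scheme (X : kfunctor) : Prop :=
  is_sheaf X /\
  exists (I : Type) (U : I -> subfunctor X),
    (forall i, is_open (U i) /\ is_affine (sub_functor (U i))) /\
    (forall K : kalg, is_field K -> forall x : X K, exists i, U i K x).

Program Definition fiber_product (X Y Y' : kfunctor) (f : kmor X Y)
    (b : kmor Y' Y) : kfunctor :=
  @KFunctor (fun A => {p : X A * Y' A | f A p.1 = b A p.2})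
    (fun A B h p => exist _ (fmap h (sval p).1, fmap h (sval p).2) _) _ _.
Next Obligation.
by move=> X Y Y' f b A B h [p e] /=; rewrite !kmor_nat e.
Qed.
Next Obligation.
by move=> X Y Y' f b A h [[x y] p] e; apply: sig_eq; rewrite /= !fmap_id.
Qed.
Next Obligation.
move=> X Y Y' f b A B D g h i [[x y] p] e; apply: sig_eq => /=.
by rewrite !(fmap_comp _ e).
Qed.

Program Definition base_change (X Y Y' : kfunctor) (f : kmor X Y)
    (b : kmor Y' Y) : kmor (fiber_product f b) Y' :=
  @KMor (fiber_product f b) Y' (fun A p => (sval p).2) _.
Next Obligation. by []. Qed.

(* The points of the underlying topological space of X are the field-valued   *)
(* points of X up to field extension. A subset of that space is therefore a   *)
(* family S K of sets of K-points (only its values at fields K matter),       *)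
(* compatible with field extensions.                                          *)
Definition is_point_set (X : kfunctor) (S : forall K, set (X K)) : Prop :=
  forall K L (f : khom K L), is_field K -> is_field L ->
  forall x : X K, S L (fmap f x) <-> S K x.

Definition is_open_set (X : kfunctor) (S : forall K, set (X K)) : Prop :=
  exists2 U : subfunctor X, is_open U &
    forall K, is_field K -> forall x : X K, U K x <-> S K x.

Definition is_surjective (X Y : kfunctor) (f : kmor X Y) : Prop :=
  forall K, is_field K -> forall y : Y K,
  exists L (h : khom K L) (x : X L), is_field L /\ f L x = fmap h y.

Definition is_submersive (X Y : kfunctor) (f : kmor X Y) : Prop :=
  is_surjective f /\
  forall S : (forall K, set (Y K)), is_point_set S ->
    is_open_set S <-> is_open_set (fun K => [set x | S K (f K x)]).

Definition is_universally_submersive (X Y : kfunctor) (f : kmor X Y) : Prop :=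
  forall (Y' : kfunctor) (b : kmor Y' Y), is_scheme Y' ->
    is_submersive (base_change f b).

Record kgroup := KGroup {
  kgroup_functor :> kfunctor;
  gone : forall A, kgroup_functor A;
  ginv : forall A, kgroup_functor A -> kgroup_functor A;
  gmul : forall A, kgroup_functor A -> kgroup_functor A -> kgroup_functor A;
  gmulA : forall A, associative (@gmul A);
  gmul1g : forall A, left_id (gone A) (@gmul A);
  gmulVg : forall A, left_inverse (gone A) (@ginv A) (@gmul A);
  fmap_gmul : forall A B (f : khom A B) g h,
    fmap f (gmul g h) = gmul (fmap f g) (fmap f h) }.

Section GroupTheory.
Variables (G : kgroup) (A : kalg).
Implicit Types g h : G A.

Lemma gmulgV g : gmul g (ginv g) = gone G A.
Proof.
rewrite -[LHS]gmul1g -{1}(gmulVg (ginv g)) -gmulA.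
by rewrite (gmulA (ginv g)) gmulVg gmul1g gmulVg.
Qed.

Lemma gmulg1 g : gmul g (gone G A) = g.
Proof. by rewrite -(gmulVg g) gmulA gmulgV gmul1g. Qed.

Lemma gmulKg g h : gmul (ginv g) (gmul g h) = h.
Proof. by rewrite gmulA gmulVg gmul1g. Qed.

Lemma gmulKVg g h : gmul g (gmul (ginv g) h) = h.
Proof. by rewrite gmulA gmulgV gmul1g. Qed.

Lemma gmulgI g h1 h2 : gmul g h1 = gmul g h2 -> h1 = h2.
Proof. by move=> e; rewrite -(gmulKg g h1) e gmulKg. Qed.

Lemma ginvM g h : ginv (gmul g h) = gmul (ginv h) (ginv g).
Proof.
apply: (@gmulgI (gmul g h)).
by rewrite gmulgV -gmulA gmulKVg gmulgV.
Qed.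

End GroupTheory.

Lemma fmap_gone (G : kgroup) A B (f : khom A B) : fmap f (gone G A) = gone G B.
Proof.
have := congr1 (fmap f) (gmul1g (gone G A)); rewrite fmap_gmul => e.
by rewrite -[LHS](gmulKg (fmap f (gone G A))) e gmulVg.
Qed.

Lemma fmap_ginv (G : kgroup) A B (f : khom A B) (g : G A) :
  fmap f (ginv g) = ginv (fmap f g).
Proof.
have := congr1 (fmap f) (gmulVg g); rewrite fmap_gmul fmap_gone => e.
by rewrite -[LHS]gmulg1 -(gmulgV (fmap f g)) gmulA e gmul1g.
Qed.

Record normal_subgroup (G : kgroup) := NormalSubgroup {
  nsub :> subfunctor G;
  nsub1 : forall A, nsub A (gone G A);
  nsubM : forall A g h, nsub A g -> nsub A h -> nsub A (gmul g h);
  nsubV : forall A g, nsub A g -> nsub A (ginv g);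
  nsubJ : forall A g h, nsub A h -> nsub A (gmul (ginv g) (gmul h g)) }.

Section Quotient.
Variables (G : kgroup) (H : normal_subgroup G).

Definition coset A (g : G A) : set (G A) := [set x | H A (gmul (ginv g) x)].

Definition quot_points A : Type := {c : set (G A) | exists g, c = coset g}.

Definition quot_class A (g : G A) : quot_points A :=
  exist _ (coset g) (ex_intro _ g erefl).

Definition quot_repr A (c : quot_points A) : G A := sval (cid (svalP c)).

Lemma quot_reprK A : cancel (@quot_repr A) (@quot_class A).
Proof. by move=> c; apply: sig_eq; rewrite /= -(svalP (cid (svalP c))). Qed.

Lemma quot_classP A (g h : G A) :
  quot_class g = quot_class h <-> H A (gmul (ginv g) h).
Proof.
split=> [/(congr1 sval) /= e|Hgh].
  have : coset h h by rewrite /coset /= gmulVg; exact: nsub1.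
  by rewrite -e.
apply: sig_eq => /=; apply/seteqP; split => x; rewrite /coset /= => Hx.
  suff -> : gmul (ginv h) x = gmul (ginv (gmul (ginv g) h)) (gmul (ginv g) x).
    by apply: nsubM => //; apply: nsubV.
  apply: (@gmulgI G A (gmul (ginv g) h)).
  by rewrite gmulKVg -gmulA gmulKVg.
have := nsubM Hgh Hx.
by rewrite -gmulA gmulKVg.
Qed.

Lemma quot_repr_class A (g : G A) :
  H A (gmul (ginv g) (quot_repr (quot_class g))).
Proof. by apply/quot_classP; rewrite quot_reprK. Qed.

Definition quot_mul A (c d : quot_points A) : quot_points A :=
  quot_class (gmul (quot_repr c) (quot_repr d)).

Definition quot_fmap A B (f : khom A B) (c : quot_points A) : quot_points B :=
  quot_class (fmap f (quot_repr c)).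

Lemma quot_mulE A (g h : G A) :
  quot_mul (quot_class g) (quot_class h) = quot_class (gmul g h).
Proof.
apply/esym/quot_classP.
set g' := quot_repr _; set h' := quot_repr _.
have Hg : H A (gmul (ginv g) g') := quot_repr_class g.
have Hh : H A (gmul (ginv h) h') := quot_repr_class h.
have -> : gmul (ginv (gmul g h)) (gmul g' h') =
    gmul (gmul (ginv h) (gmul (gmul (ginv g) g') h)) (gmul (ginv h) h').
  by rewrite ginvM -!gmulA gmulKVg.
by apply: nsubM => //; apply: nsubJ.
Qed.

Lemma quot_fmapE A B (f : khom A B) (g : G A) :
  quot_fmap f (quot_class g) = quot_class (fmap f g).
Proof.
apply/esym/quot_classP; rewrite -fmap_ginv -fmap_gmul.
by apply: sub_fmap; exact: quot_repr_class.
Qed.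

Program Definition quot_functor : kfunctor :=
  @KFunctor quot_points quot_fmap _ _.
Next Obligation.
by move=> A f c e; rewrite /quot_fmap fmap_id // quot_reprK.
Qed.
Next Obligation.
move=> A B D f g h c e.
by rewrite -(quot_reprK c) !quot_fmapE (fmap_comp _ e).
Qed.

(* The presheaf quotient A |-> G(A) / H(A). It is used below for the torus    *)
(* and a subtorus of it; a subtorus is a direct factor of a torus, so that no *)
(* sheafification is needed in this case.                                     *)
Program Definition quot_group : kgroup :=
  @KGroup quot_functor (fun A => quot_class (gone G A))
    (fun A c => quot_class (ginv (quot_repr c))) quot_mul _ _ _ _.
Next Obligation.
move=> A c d e; rewrite -(quot_reprK c) -(quot_reprK d) -(quot_reprK e).
by rewrite !quot_mulE gmulA.
Qed.
Next Obligation. by move=> A c; rewrite -(quot_reprK c) quot_mulE gmul1g. Qed.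
Next Obligation.
by move=> A c; rewrite -{2}(quot_reprK c) quot_mulE gmulVg.
Qed.
Next Obligation.
move=> A B f c d; rewrite /= -(quot_reprK c) -(quot_reprK d).
by rewrite quot_mulE !quot_fmapE quot_mulE fmap_gmul.
Qed.

End Quotient.

Record action (G : kgroup) (X : kfunctor) := Action {
  act :> forall A, X A -> G A -> X A;
  act1 : forall A (x : X A), act x (gone G A) = x;
  actM : forall A (x : X A) g h, act x (gmul g h) = act (act x g) h;
  fmap_act : forall A B (f : khom A B) x g,
    fmap f (act x g) = act (fmap f x) (fmap f g) }.

Section Actions.
Variables (G : kgroup) (X : kfunctor) (a : action G X).

(* The elements that fix every point of X, with values in any algebra. If all *)
(* the points of X have the same isotropy group, then this is that group.     *)
Program Definition stab_sub : subfunctor G :=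
  @SubFunctor G (fun A => [set g |
    forall B (f : khom A B) (x : X B), a B x (fmap f g) = x]) _.
Next Obligation.
move=> A B f g Sg D h x.
by rewrite -(@fmap_comp _ _ _ _ f h (kcomp h f)).
Qed.

Program Definition stab : normal_subgroup G :=
  @NormalSubgroup G stab_sub _ _ _ _.
Next Obligation. by move=> A B f x; rewrite fmap_gone act1. Qed.
Next Obligation.
by move=> A g h Sg Sh B f x; rewrite fmap_gmul actM Sg Sh.
Qed.
Next Obligation.
move=> A g Sg B f x; rewrite -{1}(Sg B f x) -actM fmap_ginv gmulgV.
exact: act1.
Qed.
Next Obligation.
move=> A g h Sh B f x; rewrite !fmap_gmul !actM Sh -actM fmap_ginv gmulVg.
exact: act1.
Qed.

Lemma act_repr A (x : X A) (g : G A) :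
  a A x (quot_repr (quot_class stab g)) = a A x g.
Proof.
set h := quot_repr _; rewrite -(gmulKVg g h) actM.
have idE : (@idfun A : A -> A) =1 id by [].
have S : stab A (gmul (ginv g) h) := quot_repr_class stab g.
pose i : khom A A := @KHom A A idfun (fun=> erefl).
by have := S A i (a A x g); rewrite (fmap_id _ (idE : i =1 id)).
Qed.

Program Definition quot_action : action (quot_group stab) X :=
  @Action (quot_group stab) X (fun A x c => a A x (quot_repr c)) _ _ _.
Next Obligation. by move=> A x /=; rewrite act_repr act1. Qed.
Next Obligation. by move=> A x c d /=; rewrite act_repr actM. Qed.
Next Obligation.
by move=> A B f x c /=; rewrite /quot_fmap act_repr fmap_act.
Qed.

Definition is_invariant (Y : kfunctor) (f : kmor X Y) : Prop :=
  forall A (x : X A) (g : G A), f A (a A x g) = f A x.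

Definition is_categorical_quotient (Y : kfunctor) (f : kmor X Y) : Prop :=
  is_invariant f /\
  forall (Z : kfunctor) (h : kmor X Z), is_scheme Z -> is_invariant h ->
  exists! u : kmor Y Z, forall A (x : X A), h A x = u A (f A x).

(* The image of G x X -> X x X, (g, x) |-> (x.g, x), contains the fibre       *)
(* product of X with itself over Y, as sets of points; the converse inclusion *)
(* is the invariance of f.                                                    *)
Definition has_orbit_fibers (Y : kfunctor) (f : kmor X Y) : Prop :=
  forall K, is_field K -> forall x y : X K, f K x = f K y ->
  exists L (h : khom K L) (g : G L),
    is_field L /\ fmap h x = a L (fmap h y) g.

(* f sends an A-valued point to its orbit: the A-valued points of Y are the   *)
(* orbits of G(A) on X(A).                                                    *)
Definition is_orbit_map (Y : kfunctor) (f : kmor X Y) (A : kalg) : Prop :=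
  forall y : Y A, exists x : X A,
  forall x' : X A, f A x' = y <-> exists g : G A, x' = a A x g.

(* A function on the preimage of an open U in Y descends uniquely to U if and *)
(* only if it is invariant.                                                   *)
Definition invariant_functions_descend (Y : kfunctor) (f : kmor X Y) : Prop :=
  forall U : subfunctor Y, is_open U ->
  forall p : kmor (sub_functor (preimage_sub f U)) affine_line,
    (forall A (x : X A) (g : G A) (Ux : preimage_sub f U A x)
       (Uxg : preimage_sub f U A (a A x g)),
       p A (exist _ _ Uxg) = p A (exist _ _ Ux))
    <->
    exists! q : kmor (sub_functor U) affine_line,
      forall A (x : X A) (Ux : U A (f A x)),
        p A (exist _ x Ux) = q A (exist _ (f A x) Ux).

(* Mumford, Geometric Invariant Theory, Definition 0.6. *)
Definition is_geometric_quotient (Y : kfunctor) (f : kmor X Y) : Prop :=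
  [/\ is_invariant f,
      is_surjective f /\ has_orbit_fibers f,
      is_submersive f
    & invariant_functions_descend f].

End Actions.

Program Definition base_change_action (G : kgroup) (X : kfunctor)
    (a : action G X) (Y : kfunctor) (f : kmor X Y) (inv : is_invariant a f)
    (Y' : kfunctor) (b : kmor Y' Y) : action G (fiber_product f b) :=
  @Action G (fiber_product f b)
    (fun A p g => exist _ (a A (sval p).1 g, (sval p).2) _) _ _ _.
Next Obligation.
by move=> G X a Y f inv Y' b A [p e] g /=; rewrite inv.
Qed.
Next Obligation.
by move=> G X a Y f inv Y' b A [[x y] e]; apply: sig_eq; rewrite /= act1.
Qed.
Next Obligation.
by move=> G X a Y f inv Y' b A [[x y] e] g h; apply: sig_eq; rewrite /= actM.
Qed.
Next Obligation.
move=> G X a Y f inv Y' b A B h [[x y] e] g; apply: sig_eq => /=.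
by rewrite fmap_act.
Qed.

Section UniversalQuotients.
Variables (G : kgroup) (X : kfunctor) (a : action G X).
Variables (Y : kfunctor) (f : kmor X Y).

Definition is_universal_geometric_quotient : Prop :=
  exists inv : is_invariant a f,
  forall (Y' : kfunctor) (b : kmor Y' Y), is_scheme Y' ->
    is_geometric_quotient (base_change_action inv b) (base_change f b).

Definition is_universal_categorical_quotient : Prop :=
  exists inv : is_invariant a f,
  forall (Y' : kfunctor) (b : kmor Y' Y), is_scheme Y' ->
    is_categorical_quotient (base_change_action inv b) (base_change f b).

End UniversalQuotients.

End Schemes.

Definition base_ring (k : comPzRingType) : kalg k := @KAlg k k idfun.

Definition dsubset (n d : nat) := {I : {set 'I_n} | #|I| == d}.

Record matroid (n d : nat) := Matroid {
  bases : {set {set 'I_n}};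
  bases_card : forall I, I \in bases -> #|I| = d;
  bases_neq0 : exists I, I \in bases;
  bases_exchange : forall I J, I \in bases -> J \in bases ->
    forall i, i \in I :\: J ->
    exists2 j, j \in J :\: I & j |: (I :\ i) \in bases }.

Section Polynomials.
Variables (k : comNzRingType) (N : nat).

(* mpoly.mmap requires its target to be a nonzero ring. *)
Definition poly_eval (A : kalg k) (p : {mpoly k[N]}) (h : 'I_N -> A) : A :=
  \sum_(m <- msupp p) kalg_str A p@_m * \prod_(v < N) h v ^+ m v.

Lemma poly_evalE (A : kalg k) (p : {mpoly k[N]}) (h : 'I_N -> A) r :
  uniq r -> {subset msupp p <= r} ->
  poly_eval p h = \sum_(m <- r) kalg_str A p@_m * \prod_(v < N) h v ^+ m v.
Proof.
move=> ur sr; rewrite /poly_eval [RHS](bigID (fun m => m \in msupp p)) /=.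
rewrite [X in _ + X]big1 ?addr0; last first.
  by move=> m /memN_msupp_eq0 ->; rewrite rmorph0 mul0r.
rewrite -[RHS]big_filter; apply: perm_big; apply: uniq_perm.
- exact: msupp_uniq.
- exact: filter_uniq.
- move=> m; rewrite mem_filter.
  by case: (boolP (m \in msupp p)) => // /sr ->.
Qed.

Lemma poly_eval_fmap (A B : kalg k) (f : khom A B) p (h : 'I_N -> A) :
  poly_eval p (f \o h) = f (poly_eval p h).
Proof.
rewrite /poly_eval rmorph_sum; apply: eq_bigr => m _.
rewrite rmorphM khom_str rmorph_prod; congr (_ * _).
by apply: eq_bigr => v _; rewrite rmorphXn.
Qed.

Lemma eq_poly_eval (A : kalg k) p (h h' : 'I_N -> A) :
  h =1 h' -> poly_eval p h = poly_eval p h'.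
Proof. by move=> /funext ->. Qed.

End Polynomials.

(* Polynomial relations on a set of points that is stable under rescaling     *)
(* some of the coordinates are stable under the same rescaling over any       *)
(* algebra.                                                                   *)
Lemma poly_eval_scale (K : numFieldType) (N : nat) (c : 'I_N -> nat)
    (S : set ('I_N -> K)) (A : kalg K) (u : A) (h : 'I_N -> A) :
  (forall (q : 'I_N -> K) (s : K), s != 0 -> S q ->
     S (fun v => s ^+ c v * q v)) ->
  (forall p, (forall q, S q -> poly_eval (A := base_ring K) p q = 0) ->
     poly_eval p h = 0) ->
  forall p, (forall q, S q -> poly_eval (A := base_ring K) p q = 0) ->
     poly_eval p (fun v => u ^+ c v * h v) = 0.
Proof.
move=> Sscale Sh p Sp.
pose W (m : 'X_{1..N}) : nat := (\sum_(v < N) c v * m v)%N.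
have monE (B : comPzRingType) (w : B) (g : 'I_N -> B) (m : 'X_{1..N}) :
    \prod_(v < N) (w ^+ c v * g v) ^+ m v =
    w ^+ W m * \prod_(v < N) g v ^+ m v.
  rewrite (eq_bigr (fun v => w ^+ (c v * m v) * g v ^+ m v)); last first.
    by move=> v _; rewrite exprMn exprM.
  by rewrite big_split /= -expr_sum.
pose pw e : {mpoly K[N]} := \sum_(m <- msupp p | W m == e) p@_m *: 'X_[m].
have pw_coeff e m :
    (pw e)@_m = if (m \in msupp p) && (W m == e) then p@_m else 0.
  rewrite /pw raddf_sum /=.
  case: ifP => [/andP[mp We]|mN].
    rewrite big_mkcond (bigD1_seq m) //= ?msupp_uniq // We mcoeffZ mcoeffX.
    rewrite eqxx mulr1 big1 ?addr0 // => m' /negbTE ne.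
    by case: ifP => // _; rewrite mcoeffZ mcoeffX ne mulr0.
  rewrite big_seq_cond big1 // => m' /andP[m'p We]; rewrite mcoeffZ mcoeffX.
  by case: eqP => [em|_]; rewrite ?mulr0 // -em m'p We in mN *.
have pw_eval (B : kalg K) (g : 'I_N -> B) e :
    poly_eval (pw e) g = \sum_(m <- msupp p | W m == e)
      kalg_str B p@_m * \prod_(v < N) g v ^+ m v.
  rewrite (@poly_evalE _ _ _ _ _ (msupp p)) ?msupp_uniq //; last first.
    move=> m; rewrite mcoeff_msupp pw_coeff.
    by case: ifP => [/andP[]|]; rewrite ?eqxx.
  rewrite [RHS]big_mkcond [RHS]big_seq [LHS]big_seq; apply: eq_bigr => m mp.
  by rewrite pw_coeff mp /=; case: ifP => // _; rewrite rmorph0 mul0r.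
pose D := (\max_(m <- msupp p) W m).+1.
have WD m : m \in msupp p -> (W m < D)%N.
  by move=> mp; rewrite ltnS; exact: leq_bigmax_seq.
have split_eval (B : kalg K) (w : B) (g : 'I_N -> B) :
    poly_eval p (fun v => w ^+ c v * g v) =
    \sum_(e < D) w ^+ e * poly_eval (pw e) g.
  under [RHS]eq_bigr do rewrite pw_eval big_mkcond mulr_sumr /=.
  rewrite exchange_big /= /poly_eval big_seq [RHS]big_seq.
  apply: eq_bigr => m mp; rewrite monE; set M := \prod_(v < N) _.
  rewrite (bigD1 (Ordinal (WD _ mp))) //= eqxx.
  rewrite big1 ?addr0 ?mulrA ?[_ * w ^+ _]mulrC // => e ne.
  case: eqP => [We|_]; last by rewrite mulr0.
  by case/eqP: ne; apply: val_inj; rewrite /= We.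
have Spw e q : S q -> poly_eval (A := base_ring K) (pw e) q = 0.
  move=> Sq; pose P := \poly_(i < D) poly_eval (A := base_ring K) (pw i) q.
  have Pr (s : K) : s != 0 -> root P s.
    move=> s0; rewrite rootE horner_poly.
    have := Sp _ (Sscale q s s0 Sq).
    rewrite (@split_eval (base_ring K)) => H.
    by apply/eqP; rewrite -[RHS]H; apply: eq_bigr => i _; rewrite mulrC.
  have P0 : P = 0.
    pose rs : seq K := [seq (i.+1)%:R | i <- iota 0 (size P)].
    apply: (@roots_geq_poly_eq0 _ _ rs).
    - by apply/allP => _ /mapP[i _ ->]; apply: Pr; rewrite pnatr_eq0.
    - rewrite map_inj_uniq ?iota_uniq // => i j /eqP.
      by rewrite eqr_nat eqSS => /eqP.
    - by rewrite size_map size_iota.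
  case: (ltnP e D) => [eD|De].
    by have := congr1 (fun r : {poly K} => r`_e) P0; rewrite coef_poly eD coef0.
  rewrite pw_eval big_seq_cond big1 // => m /andP[/WD mD /eqP We].
  by move: mD; rewrite We ltnNge De.
rewrite split_eval big1 // => e _.
by rewrite Sh ?mulr0 // => q; exact: Spw.
Qed.

Section RowSpace.
Variable n : nat.

Definition row_space (A : pzRingType) (m : nat) (L : 'M[A]_(m, n)) :
  set 'rV[A]_n := range (fun u : 'rV[A]_m => u *m L).

Lemma row_spaceP (A : pzRingType) m p (L : 'M[A]_(m, n)) (P : 'M[A]_(p, n)) :
  row_space L `<=` row_space P <-> exists U, L = U *m P.
Proof.
split=> [LP|[U ->] _ [u _ <-]]; last by exists (u *m U) => //; rewrite mulmxA.
have /choice[U HU] : forall i, exists u, row i L = u *m P.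
  move=> i; have [|u _ <-] := LP (row i L); last by exists u.
  by exists (delta_mx 0 i) => //; rewrite -rowE.
exists (\matrix_i U i); apply/row_matrixP => i.
by rewrite row_mul rowK HU.
Qed.

(* The submodule of B^n generated by the image of W. *)
Definition extend_scalars (A B : pzRingType) (f : {rmorphism A -> B})
    (W : set 'rV[A]_n) : set 'rV[B]_n :=
  [set v | exists m (b : 'rV[B]_m) (w : 'M[A]_(m, n)),
     (forall i, W (row i w)) /\ v = b *m map_mx f w].

Lemma extend_row_space (A B : pzRingType) (f : {rmorphism A -> B}) m
  (L : 'M[A]_(m, n)) :
  extend_scalars f (row_space L) = row_space (map_mx f L).
Proof.
apply/seteqP; split => [v [p [b [w [Ww ->]]]]|_ [u _ <-]]; last first.
  exists m, u, L; split=> // i.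
  by exists (delta_mx 0 i) => //; rewrite -rowE.
have /choice[U HU] : forall i, exists u, row i w = u *m L.
  by move=> i; have [u _ <-] := Ww i; exists u.
have -> : w = (\matrix_i U i) *m L.
  by apply/row_matrixP => i; rewrite row_mul rowK HU.
by rewrite map_mxM mulmxA; eexists.
Qed.

Lemma row_space_mulr (A : pzRingType) m p (L : 'M[A]_(m, n))
  (D : 'M[A]_(n, p)) :
  [set v *m D | v in row_space L] = range (fun u : 'rV[A]_m => u *m (L *m D)).
Proof.
apply/seteqP; split => [_ [_ [u _ <-] <-]|_ [u _ <-]].
  by exists u => //; rewrite mulmxA.
by exists (u *m L); [exists u|rewrite mulmxA].
Qed.

End RowSpace.

(* The elements of I, in increasing order. *)
Definition dsubset_nth (n d : nat) (I : dsubset n d) (c : 'I_d) : 'I_n :=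
  enum_val (cast_ord (esym (eqP (valP I))) c).

(* The Pluecker coordinate p_I of the row space of L. *)
Definition minor (A : comPzRingType) (n d : nat) (L : 'M[A]_(d, n))
    (I : dsubset n d) : A := \det (colsub (dsubset_nth I) L).

Lemma map_minor (A B : comPzRingType) (f : {rmorphism A -> B}) n d
  (L : 'M[A]_(d, n)) (I : dsubset n d) :
  minor (map_mx f L) I = f (minor L I).
Proof.
rewrite /minor -det_map_mx; congr (\det _).
by apply/matrixP => i j; rewrite !mxE.
Qed.

Lemma minor_diag (A : comPzRingType) n d (L : 'M[A]_(d, n)) (t : 'rV[A]_n)
  (I : dsubset n d) :
  minor (L *m diag_mx t) I =
  (\prod_(j < n) t 0 j ^+ (j \in val I)) * minor L I.
Proof.
rewrite /minor; set e := dsubset_nth I.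
have -> : colsub e (L *m diag_mx t) = colsub e L *m diag_mx (colsub e t).
  by apply/matrixP => i j; rewrite !mul_mx_diag !mxE.
rewrite det_mulmx det_diag mulrC; congr (_ * _).
rewrite (eq_bigr (fun c => t 0 (e c))); last by move=> c _; rewrite mxE.
rewrite [RHS](eq_bigr (fun j => if j \in val I then t 0 j else 1)); last first.
  by move=> j _; case: (j \in _).
rewrite -(big_mkcond (fun j => j \in val I)) /=.
rewrite (big_enum_val (fun j => t 0 j)) /=.
have h := eqP (valP I).
rewrite (reindex (cast_ord (esym h))) /=; last first.
  by apply: onW_bij; exists (cast_ord h); [exact: cast_ordKV|exact: cast_ordK].
apply: eq_bigr => c _; rewrite /e /dsubset_nth; congr (t 0 (enum_val _)).
exact: val_inj.
Qed.

Section Torus.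
Variables (k : comPzRingType) (n : nat).

(* Invertible diagonal matrices, encoded by their diagonals. *)
Definition torus_points (A : kalg k) : Type :=
  {t : 'rV[A]_n | forall j, exists y, t 0 j * y = 1}.

Program Definition torus_functor : kfunctor k :=
  @KFunctor k torus_points (fun A B f t => exist _ (map_mx f (sval t)) _) _ _.
Next Obligation.
move=> A B f [t tP] j /=; have [y ty] := tP j.
by exists (f y); rewrite mxE -rmorphM ty rmorph1.
Qed.
Next Obligation.
by move=> A f t e; apply: sig_eq; apply/rowP => j; rewrite /= mxE e.
Qed.
Next Obligation.
by move=> A B D f g h t e; apply: sig_eq; apply/rowP => j; rewrite /= !mxE e.
Qed.

Program Definition torus : kgroup k :=
  @KGroup k torus_functor (fun A => exist _ (const_mx 1) _)
    (fun A t => exist _ (\row_j sval (cid (svalP t j))) _)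
    (fun A t u => exist _ (\row_j (sval t 0 j * sval u 0 j)) _) _ _ _ _.
Next Obligation. by move=> A j; exists 1; rewrite mxE mulr1. Qed.
Next Obligation.
move=> A t j; exists (sval t 0 j); rewrite mxE mulrC.
exact: (svalP (cid (svalP t j))).
Qed.
Next Obligation.
move=> A [t tP] [u uP] j /=; have [y ty] := tP j; have [z uz] := uP j.
by exists (y * z); rewrite mxE mulrACA ty uz mulr1.
Qed.
Next Obligation.
by move=> A t u v; apply: sig_eq; apply/rowP => j; rewrite /= !mxE mulrA.
Qed.
Next Obligation.
by move=> A t; apply: sig_eq; apply/rowP => j; rewrite /= !mxE mul1r.
Qed.
Next Obligation.
move=> A t; apply: sig_eq; apply/rowP => j; rewrite /= !mxE mulrC.
exact: (svalP (cid (svalP t j))).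
Qed.
Next Obligation.
by move=> A B f t u; apply: sig_eq; apply/rowP => j; rewrite /= !mxE rmorphM.
Qed.

End Torus.

Section ThinCell.
Variables (K : numFieldType) (n k : nat) (d : 'I_k -> nat).
Variable M : forall i, matroid n (d i).

Definition plucker_index : finType := {i : 'I_k & dsubset n (d i)}.

Definition plucker (A : comPzRingType) (L : forall i, 'M[A]_(d i, n))
    (v : 'I_#|plucker_index|) : A :=
  minor (L (tag (enum_val v))) (tagged (enum_val v)).

(* The matrices L i represent a point of the thin Schubert cell of M, as a    *)
(* set of flags of subspaces of K^n.                                          *)
Definition is_cell_flag (L : forall i, 'M[K]_(d i, n)) : Prop :=
  (forall i (I : dsubset n (d i)), minor (L i) I <> 0 <-> val I \in bases (M i))
  /\ (forall i j : 'I_k, (i <= j)%N -> row_space (L i) `<=` row_space (L j)).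

(* The thin Schubert cell, with its structure of reduced locally closed       *)
(* subscheme of the flag variety. It is the intersection of its closure with  *)
(* the open set where p_I is invertible for every basis I of M i. A flag      *)
(* (W i) with values in A lies in this open set only if W i maps              *)
(* isomorphically to A^I for every basis I of M i; W i is then the row space  *)
(* of a matrix. The reduced closure is cut out by the polynomials in the      *)
(* Pluecker coordinates that vanish on all representatives of all the points  *)
(* of the cell (such polynomials form a multihomogeneous ideal).              *)
Definition is_cell_point (A : kalg K) (W : forall i : 'I_k, set 'rV[A]_n) :=
  exists L : forall i, 'M[A]_(d i, n),
  [/\ forall i, W i = row_space (L i),
      forall i j : 'I_k, (i <= j)%N -> W i `<=` W j,
      forall i (I : dsubset n (d i)),
        if val I \in bases (M i) then exists y, minor (L i) I * y = 1
        else minor (L i) I = 0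
    & forall p : {mpoly K[#|plucker_index|]},
        (forall L0, is_cell_flag L0 ->
           poly_eval (A := base_ring K) p (plucker L0) = 0) ->
        poly_eval p (plucker L) = 0].

Lemma is_cell_pointP (W : forall i : 'I_k, set 'rV[K]_n) :
  is_cell_point (A := base_ring K) W <->
  exists2 L, is_cell_flag L & forall i, W i = row_space (L i).
Proof.
split=> [[L [WL Wflag Lunit _]]|[L LP WL]]; exists L => //.
  split=> [i I|i j ij]; last by rewrite -!WL; exact: Wflag.
  have := Lunit i I; case: ifP => _; last by split.
  case=> y Ly; split=> // _ m0; have /eqP := oner_neq0 K; apply; rewrite -[LHS]Ly.
  by apply: etrans (congr1 (fun z => z * y) m0) _; exact: mul0r.
have [LB Lflag] := LP; split=> //.
- by move=> i j ij; rewrite !WL; exact: Lflag.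
- move=> i I; case: ifP => [/LB /eqP m0|/negP IB].
    by exists (minor (L i) I)^-1; rewrite mulfV.
  by apply: contrapT => m0; apply: IB; apply/LB.
- by move=> p; apply.
Qed.

Lemma extend_cell_point A B (f : khom A B) (W : forall i, set 'rV[A]_n) :
  is_cell_point W -> is_cell_point (fun i => extend_scalars f (W i)).
Proof.
case=> L [WL Wflag Lunit Lrel]; exists (fun i => map_mx f (L i)); split.
- by move=> i; rewrite WL extend_row_space.
- move=> i j /Wflag; rewrite !WL !extend_row_space => /row_spaceP[U ->].
  by apply/row_spaceP; exists (map_mx f U); rewrite map_mxM.
- move=> i I; have := Lunit i I; rewrite map_minor.
  case: ifP => _ => [[y Ly]|->]; last by rewrite rmorph0.
  by exists (f y); rewrite -rmorphM Ly rmorph1.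
- move=> p /Lrel Lp; rewrite -[RHS](rmorph0 f) -Lp -poly_eval_fmap.
  by apply: eq_poly_eval => v; rewrite /plucker map_minor.
Qed.

Program Definition thin_cell : kfunctor K :=
  @KFunctor K
    (fun A => {W : forall i : 'I_k, set 'rV[A]_n | is_cell_point W})
    (fun A B f W => exist _ _ (extend_cell_point f (svalP W))) _ _.
Next Obligation.
move=> A f [W [L [WL WP LP RP]]] e; apply: sig_eq.
apply: functional_extensionality_dep => i /=.
rewrite WL extend_row_space; congr row_space.
by apply/matrixP => r c; rewrite mxE e.
Qed.
Next Obligation.
move=> A B D f g h [W [L [WL WP LP RP]]] e; apply: sig_eq.
apply: functional_extensionality_dep => i /=.
rewrite WL !extend_row_space; congr row_space.
by apply/matrixP => r c; rewrite !mxE e.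
Qed.

Lemma cell_flag_diag (L : forall i, 'M[K]_(d i, n)) (t : 'rV[K]_n) :
  (forall j, t 0 j != 0) -> is_cell_flag L ->
  is_cell_flag (fun i => L i *m diag_mx t).
Proof.
move=> t0 [LB Lflag]; split=> [i I|i j /Lflag /row_spaceP[U LU]].
  rewrite minor_diag -LB; split=> [H e|/eqP H].
    by apply: H; rewrite e mulr0.
  apply/eqP; rewrite mulf_neq0 //; apply/prodf_neq0 => j _.
  by rewrite expf_neq0.
by apply/row_spaceP; exists U; rewrite LU mulmxA.
Qed.

Lemma plucker_diag (A : comPzRingType) (L : forall i, 'M[A]_(d i, n)) t v :
  plucker (fun i => L i *m diag_mx t) v =
  (\prod_(j < n) t 0 j ^+ (j \in val (tagged (enum_val v)))) * plucker L v.
Proof. by rewrite /plucker minor_diag. Qed.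

Lemma cell_point_diag (A : kalg K) (W : forall i, set 'rV[A]_n)
    (t : torus_points n A) :
  is_cell_point W ->
  is_cell_point (fun i => [set v *m diag_mx (sval t) | v in W i]).
Proof.
case=> L [WL Wflag Lunit Lrel]; exists (fun i => L i *m diag_mx (sval t)).
split.
- by move=> i; rewrite WL row_space_mulr.
- by move=> i j ij; apply: image_subset; exact: Wflag.
- move=> i I; have := Lunit i I; rewrite minor_diag.
  case: ifP => _ => [[y Ly]|->]; last by rewrite mulr0.
  have [z tz] : exists z, \prod_(j < n) sval t 0 j ^+ (j \in val I) * z = 1.
    exists (\prod_(j < n) sval (cid (svalP t j)) ^+ (j \in val I)).
    rewrite -big_split big1 //= => j _.
    by rewrite -exprMn (svalP (cid (svalP t j))) expr1n.
  by exists (z * y); rewrite mulrACA tz Ly mulr1.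
pose S : set ('I_#|plucker_index| -> K) :=
  [set q | exists2 L0, is_cell_flag L0 & q = plucker L0].
pose c (j : 'I_n) (v : 'I_#|plucker_index|) : nat :=
  j \in val (tagged (enum_val v)).
have Sscale j (q : _ -> K) (s : K) :
    s != 0 -> S q -> S (fun v => s ^+ c j v * q v).
  move=> s0 [L0 L0P ->].
  pose t0 : 'rV[K]_n := \row_i (if i == j then s else 1).
  exists (fun i => L0 i *m diag_mx t0).
    by apply: cell_flag_diag => // i; rewrite mxE; case: ifP; rewrite ?oner_eq0.
  apply: funext => v; rewrite plucker_diag (bigD1 j) //= mxE eqxx.
  rewrite big1 ?mulr1 //.
  by move=> i /negbTE ij; rewrite mxE ij expr1n.
pose good (h : 'I_#|plucker_index| -> A) :=
  forall p : {mpoly K[#|plucker_index|]},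
  (forall q, S q -> poly_eval (A := base_ring K) p q = 0) -> poly_eval p h = 0.
suff : good (plucker (fun i => L i *m diag_mx (sval t))).
  by move=> H p Hp; apply: H => _ [L0 L0P ->]; exact: Hp.
have -> : plucker (fun i => L i *m diag_mx (sval t)) =
    fun v => (\prod_(j <- enum 'I_n) sval t 0 j ^+ c j v) * plucker L v.
  by apply: funext => v; rewrite plucker_diag big_enum.
elim: (enum 'I_n) => [|j r IH].
  under eq_fun do rewrite big_nil mul1r.
  by move=> p Hp; apply: Lrel => L0 L0P; apply: Hp; exists L0.
under eq_fun do rewrite big_cons -mulrA.
move=> p; exact: (@poly_eval_scale _ _ (c j) S _ _ _ (Sscale j) IH).
Qed.

Program Definition torus_action : action (torus K n) thin_cell :=
  @Action K (torus K n) thin_cell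
    (fun A W t => exist _ _ (cell_point_diag t (svalP W))) _ _ _.
Next Obligation.
move=> A W; apply: sig_eq; apply: functional_extensionality_dep => i /=.
by rewrite diag_const_mx; under eq_imagel do rewrite mulmx1; rewrite image_id.
Qed.
Next Obligation.
move=> A W t u; apply: sig_eq; apply: functional_extensionality_dep => i /=.
rewrite image_comp; apply: eq_imagel => v _ /=.
by rewrite -mulmxA mulmx_diag.
Qed.
Next Obligation.
move=> A B f [W [L [WL WP LP RP]]] t; apply: sig_eq.
apply: functional_extensionality_dep => i /=.
rewrite WL extend_row_space !row_space_mulr extend_row_space.
by rewrite map_mxM map_diag_mx.
Qed.

(* T / Stab_T, where Stab_T is the common isotropy group of the points of the *)
(* thin Schubert cell, and its action by right translation.                   *)
Definition cell_torus : kgroup K := quot_group (stab torus_action).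

Definition cell_torus_action : action cell_torus thin_cell :=
  quot_action torus_action.

End ThinCell.

(* Main.v *)
(* The torus T / Stab_T acts on the thin Schubert cell X as on a trivial      *)
(* principal bundle. If I and J = I \ i + j are bases of some M_m, then       *)
(* p_J / p_I is a unit on X of weight t_j / t_i. Join i and j by an edge for  *)
(* all these pairs: every j then carries a unit on X of weight                *)
(* t_j / t_(root j), where root j is a fixed vertex of its component, and     *)
(* normalized representatives of the subspaces show that the t constant on    *)
(* the components act trivially. Together these units form an equivariant map *)
(* phi from X to the torus, and Y = {phi = 1} is a closed subscheme of the    *)
(* affine scheme X that meets every orbit, with retraction                    *)
(* x |-> x.phi(x)^-1. A retraction onto a slice is a quotient in every sense, *)
(* and stays one after any base change.                                       *)

Require Import Defs.
From HB Require Import structures.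
From mathcomp Require Import all_boot all_order perm all_algebra.
From mathcomp Require Import boolp classical_sets reals complex.
From mathcomp Require Import mpoly ring.

Set Implicit Arguments.
Unset Strict Implicit.
Unset Printing Implicit Defensive.

Import Order.TTheory GRing.Theory Num.Theory.
#[local] Obligation Tactic := idtac.
Local Open Scope classical_set_scope.
Local Open Scope ring_scope.

(** * Quotients with a slice *)

(** Everything reduces to a slice: an invariant morphism [f] with a section [s] such that, over
    every algebra, each point [x] lies in the orbit of [s (f x)]. These conditions are pointwise in
    the algebra, so they survive base change ([has_slice_base_change]). They make [f] a quotient in
    every sense: fibers are orbits, while open sets, invariant functions and invariant morphisms
    descend along [s] ([slice_universal]).

    To find the slice, represent each subspace by the matrix with an identity block on the columns
    of a fixed basis. The entries, together with the inverses of the basis minors, identify the cell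
    with a closed locus in affine space ([coords_inj], [cell_ofK]). Up to sign, an entry in row [r]
    and column [j] is the Pluecker coordinate of the basis with its [r]-th element exchanged for
    [j]. So either it vanishes, or the cell carries a unit of weight [t_j / t_b], with [b] the
    exchanged element ([linked_exchange], [linked_entry]).

    Consequently every [t] constant on the classes of [linked] fixes the cell ([act_constant]), and
    a choice of units gives a map [phi] ([eqv]) whose [j]-th entry has weight
    [t_j / t_(link_repr j)]. The point [x.phi(x)^-1] depends only on the orbit of [x]
    ([cell_proj_act]), and it runs through the locus [phi = 1], which is affine by
    [zero_locus_affine] and is the slice ([cell_has_slice]). *)

Section SlicedAction.
Variable k : comPzRingType.

Definition khom_id (A : kalg k) : khom A A := @KHom k A A idfun (fun=> erefl).

Definition has_slice (G : kgroup k) (X : kfunctor k) (a : action G X)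
    (Y : kfunctor k) (f : kmor X Y) (s : kmor Y X) : Prop :=
  [/\ is_invariant a f, forall A (y : Y A), f A (s A y) = y
    & forall A (x : X A), exists g, x = a A (s A (f A x)) g].

Section Slice.
Variables (G : kgroup k) (X : kfunctor k) (a : action G X).
Variables (Y : kfunctor k) (f : kmor X Y) (s : kmor Y X).
Hypothesis slice : has_slice a f s.

Lemma slice_fiber A (x y : X A) : f A x = f A y -> exists g, x = a A y g.
Proof.
case: slice => _ _ orb e; have [g xE] := orb A x; have [h yE] := orb A y.
exists (gmul (ginv h) g); rewrite actM {1}yE -e -(actM a _ h) gmulgV act1.
exact: xE.
Qed.

Lemma slice_orbit_map A : is_orbit_map a f A.
Proof.
case: (slice) => inv sec _ y; exists (s A y) => x'; split=> [fx|[g ->]].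
  by apply: slice_fiber; rewrite sec.
by rewrite inv sec.
Qed.

Lemma slice_surjective : is_surjective f.
Proof.
case: (slice) => _ sec _ K Kf y; exists K, (khom_id K), (s K y); split=> //.
by rewrite sec fmap_id.
Qed.

Lemma slice_orbit_fibers : has_orbit_fibers a f.
Proof.
move=> K Kf x y /slice_fiber[g ->]; exists K, (khom_id K), g.
by split=> //; rewrite !fmap_id.
Qed.

Lemma preimage_open (X1 X2 : kfunctor k) (h : kmor X1 X2)
    (U : subfunctor X2) : is_open U -> is_open (preimage_sub h U).
Proof.
move=> Uo A x; have [E UE] := Uo A (h A x); exists E => B g.
by rewrite -UE /= kmor_nat.
Qed.

(** Since [f] after [s] is the identity, a set in [Y] is the preimage under [s] of its own preimage
    under [f]; openness therefore passes both ways. *)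
Lemma slice_submersive : is_submersive f.
Proof.
split; first exact: slice_surjective.
case: (slice) => _ sec _ S _; split=> -[U Uo US].
  exists (preimage_sub f U); first exact: preimage_open.
  by move=> K Kf x; exact: US.
exists (preimage_sub s U); first exact: preimage_open.
by move=> K Kf y; rewrite -[in S K y](sec K y); exact: US.
Qed.

Lemma slice_functions_descend : invariant_functions_descend a f.
Proof.
case: (slice) => inv sec orb U Uo p.
have pE A x y (u : preimage_sub f U A x) (v : preimage_sub f U A y) :
    x = y -> p A (exist _ x u) = p A (exist _ y v).
  by move=> e; subst y; rewrite (Prop_irrelevance u v).
split=> [pinv|[q [pq _]] A x g Ux Uxg]; last first.
  rewrite !pq; congr (q A _); apply: sig_eq; exact: inv.
have Us A (y : Y A) : U A y -> preimage_sub f U A (s A y) by rewrite /= sec.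
have qnat A B (h : khom A B) (y : sub_functor U A) :
    p B (exist _ _ (Us B _ (svalP (fmap h y)))) =
    fmap h (p A (exist _ _ (Us A _ (svalP y)))).
  by rewrite -kmor_nat; apply: pE; rewrite /= kmor_nat.
(* The descended function is [p] after [s]; invariance of [p] moves [x] to the slice point of its
   orbit. *)
exists (@KMor k (sub_functor U) (affine_line k) _ qnat); split=> [A x Ux|q qP].
  have [g xE] := orb A x.
  have Uxg : preimage_sub f U A (a A (s A (f A x)) g) by rewrite -xE.
  rewrite (pE _ _ _ _ Uxg) // /=.
  by rewrite (pinv A _ g (Us A _ Ux) Uxg); exact: pE.
have e A (y : sub_functor U A) : p A (exist _ _ (Us A _ (svalP y))) = q A y.
  rewrite qP; congr (q A _); apply: sig_eq; exact: sec.
case: q qP e => q qN qP e /=.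
have {}e : (fun A (y : sub_functor U A) =>
    p A (exist _ _ (Us A _ (svalP y)))) = q.
  by apply: functional_extensionality_dep => A; apply: funext => y; exact: e.
by subst q; congr KMor; exact: Prop_irrelevance.
Qed.

Lemma slice_geometric_quotient : is_geometric_quotient a f.
Proof.
split; first by case: slice.
- by split; [exact: slice_surjective|exact: slice_orbit_fibers].
- exact: slice_submersive.
- exact: slice_functions_descend.
Qed.

(** The factorization is [h] after [s], and evaluating [h = u f] on the section forces it. *)
Lemma slice_categorical_quotient : is_categorical_quotient a f.
Proof.
case: (slice) => inv sec orb; split=> // Z h _ hinv.
have unat A B (g : khom A B) (y : Y A) :
    h B (s B (fmap g y)) = fmap g (h A (s A y)) by rewrite !kmor_nat.
exists (@KMor k Y Z (fun A y => h A (s A y)) unat).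
split=> [A x|[u uN] uP] /=; first by have [g xE] := orb A x; rewrite {1}xE hinv.
have e : (fun A y => h A (s A y)) = u.
  apply: functional_extensionality_dep => A; apply: funext => y.
  by rewrite uP /= sec.
by subst u; congr KMor; exact: Prop_irrelevance.
Qed.

Lemma slice_sectionK A (y : Y A) : f A (s A y) = y.
Proof. by case: slice. Qed.

Program Definition slice_base_change (Y' : kfunctor k) (b : kmor Y' Y) :
    kmor Y' (fiber_product f b) :=
  @KMor k Y' (fiber_product f b)
    (fun A y => exist _ (s A (b A y), y) (slice_sectionK (b A y))) _.
Next Obligation.
by move=> Y' b A B g y; apply: sig_eq; rewrite /= !kmor_nat.
Qed.

End Slice.

Lemma has_slice_base_change (G : kgroup k) (X : kfunctor k) (a : action G X)
    (Y : kfunctor k) (f : kmor X Y) (s : kmor Y X) (sl : has_slice a f s)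
    (inv : is_invariant a f) (Y' : kfunctor k) (b : kmor Y' Y) :
  has_slice (base_change_action inv b) (base_change f b)
    (slice_base_change sl b).
Proof.
have [_ _ orb] := sl; split=> // A [[x y] e].
have [g xE] := orb A x; exists g; apply: sig_eq => /=; congr (_, _).
by rewrite {1}xE; move: e => /= ->.
Qed.

Lemma slice_universal (G : kgroup k) (X : kfunctor k) (a : action G X)
    (Y : kfunctor k) (f : kmor X Y) (s : kmor Y X) : has_slice a f s ->
  [/\ is_universal_geometric_quotient a f, is_universally_submersive f
    & is_universal_categorical_quotient a f].
Proof.
move=> sl; have inv : is_invariant a f by case: sl.
have slb Y' b := @has_slice_base_change _ _ _ _ _ _ sl inv Y' b.
split; [exists inv| |exists inv] => Y' b _.
- exact: slice_geometric_quotient (slb Y' b).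
- exact: slice_submersive (slb Y' b).
- exact: slice_categorical_quotient (slb Y' b).
Qed.

End SlicedAction.

(** * Functors cut out by polynomials *)

Section PolyEval.
Variables (k : comNzRingType) (N : nat) (A : kalg k) (h : 'I_N -> A).
Implicit Types p q : {mpoly k[N]}.

Lemma poly_evalD p q : poly_eval (p + q) h = poly_eval p h + poly_eval q h.
Proof.
pose r := undup (msupp p ++ msupp q).
have sr s : {subset s <= msupp p ++ msupp q} -> {subset s <= r}.
  by move=> ss m /ss; rewrite mem_undup.
rewrite !(@poly_evalE _ _ _ _ _ r) ?undup_uniq //.
- by rewrite -big_split; apply: eq_bigr => m _; rewrite mcoeffD rmorphD mulrDl.
- by apply: sr => m; rewrite mem_cat orbC => ->.
- by apply: sr => m; rewrite mem_cat => ->.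
- exact: sr (@msuppD_le _ _ p q).
Qed.

Lemma poly_eval0 : poly_eval 0 h = 0.
Proof. by apply: (addrI (poly_eval 0 h)); rewrite -poly_evalD !addr0. Qed.

Lemma poly_eval_sum (I : Type) (r : seq I) (F : I -> {mpoly k[N]}) :
  poly_eval (\sum_(i <- r) F i) h = \sum_(i <- r) poly_eval (F i) h.
Proof.
elim: r => [|i r IH]; first by rewrite !big_nil poly_eval0.
by rewrite !big_cons poly_evalD IH.
Qed.

Lemma poly_evalZX c (m : 'X_{1..N}) :
  poly_eval (c *: 'X_[m]) h = kalg_str A c * \prod_(v < N) h v ^+ m v.
Proof.
rewrite (@poly_evalE _ _ _ _ _ [:: m]) //.
  by rewrite big_seq1 mcoeffZ mcoeffX eqxx mulr1.
by move=> m' /msuppZ_le; rewrite msuppX.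
Qed.

Lemma poly_evalC c : poly_eval c%:MP h = kalg_str A c.
Proof.
rewrite -[c%:MP]mulr1 -mpolyX0 mul_mpolyC poly_evalZX big1 ?mulr1 //.
by move=> v _; rewrite mnm0E expr0.
Qed.

Lemma poly_eval1 : poly_eval 1 h = 1.
Proof. by rewrite -mpolyC1 poly_evalC rmorph1. Qed.

Lemma poly_evalX v : poly_eval 'X_v h = h v.
Proof.
have := poly_evalZX 1 U_(v); rewrite scale1r rmorph1 mul1r => ->.
rewrite (bigD1 v) //= mnm1E eqxx expr1 big1 ?mulr1 // => w /negbTE wv.
by rewrite mnm1E eq_sym wv expr0.
Qed.

Lemma poly_evalM p q : poly_eval (p * q) h = poly_eval p h * poly_eval q h.
Proof.
rewrite mpolyME poly_eval_sum big_allpairs /=.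
rewrite [poly_eval p h]/poly_eval mulr_suml.
apply: eq_bigr => m1 _; rewrite [poly_eval q h]/poly_eval mulr_sumr.
apply: eq_bigr => m2 _.
rewrite poly_evalZX rmorphM mulrACA -big_split /=; congr (_ * _).
by apply: eq_bigr => v _; rewrite mnmDE exprD.
Qed.

Lemma poly_evalN p : poly_eval (- p) h = - poly_eval p h.
Proof.
apply: (addrI (poly_eval p h)).
by rewrite -poly_evalD !subrr poly_eval0.
Qed.

End PolyEval.

(** * Polynomial functions and closed conditions over all algebras *)

Section ZeroLocus.
Variables (k : comNzRingType) (C : finType).

Definition evalf (A : kalg k) (p : {mpoly k[#|C|]}) (h : C -> A) : A :=
  poly_eval p (fun v => h (enum_val v)).

Lemma evalf_fmap (A B : kalg k) (f : khom A B) p (h : C -> A) :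
  evalf p (f \o h) = f (evalf p h).
Proof. by rewrite /evalf -poly_eval_fmap. Qed.

Lemma evalfM (A : kalg k) p q (h : C -> A) :
  evalf (p * q) h = evalf p h * evalf q h.
Proof. exact: poly_evalM. Qed.

Lemma evalfB (A : kalg k) p q (h : C -> A) :
  evalf (p - q) h = evalf p h - evalf q h.
Proof. by rewrite /evalf poly_evalD poly_evalN. Qed.

Lemma evalf1 (A : kalg k) (h : C -> A) : evalf 1 h = 1.
Proof. exact: poly_eval1. Qed.

(** One polynomial has to serve for all algebras at once, which makes [F] natural in [A]. *)
Definition regular (F : forall A : kalg k, (C -> A) -> A) : Prop :=
  exists p, forall A h, F A h = evalf p h.

Lemma regular_coord c : regular (fun A h => h c).
Proof.
by exists 'X_(enum_rank c) => A h; rewrite /evalf poly_evalX enum_rankK.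
Qed.

Lemma regular_const c : regular (fun A _ => kalg_str A c).
Proof. by exists c%:MP => A h; rewrite /evalf poly_evalC. Qed.

Lemma regular0 : regular (fun A _ => 0).
Proof. by exists 0 => A h; rewrite /evalf poly_eval0. Qed.

Lemma regular1 : regular (fun A _ => 1).
Proof. by exists 1 => A h; rewrite /evalf poly_eval1. Qed.

Lemma regularD F G :
  regular F -> regular G -> regular (fun A h => F A h + G A h).
Proof.
by move=> [p pE] [q qE]; exists (p + q) => A h; rewrite pE qE -poly_evalD.
Qed.

Lemma regularM F G :
  regular F -> regular G -> regular (fun A h => F A h * G A h).
Proof.
by move=> [p pE] [q qE]; exists (p * q) => A h; rewrite pE qE -poly_evalM.
Qed.

Lemma regular_sum (I : Type) (r : seq I) (F : I -> _) :
  (forall i, regular (F i)) -> regular (fun A h => \sum_(i <- r) F i A h).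
Proof.
move=> Fr; elim: r => [|i r IH].
  by have [p pE] := regular0; exists p => A h; rewrite big_nil -pE.
have [p pE] := regularD (Fr i) IH.
by exists p => A h; rewrite big_cons -pE.
Qed.

Lemma regular_prod (I : Type) (r : seq I) (F : I -> _) :
  (forall i, regular (F i)) -> regular (fun A h => \prod_(i <- r) F i A h).
Proof.
move=> Fr; elim: r => [|i r IH].
  by have [p pE] := regular1; exists p => A h; rewrite big_nil -pE.
have [p pE] := regularM (Fr i) IH.
by exists p => A h; rewrite big_cons -pE.
Qed.

Lemma regularX F m : regular F -> regular (fun A h => F A h ^+ m).
Proof.
move=> Fr; have [p pE] := regular_prod (iota 0 m) (fun _ => Fr).
by exists p => A h; rewrite -pE big_const_seq count_predT size_iota iter_mulr_1.
Qed.

Lemma regular_poly_eval N (p : {mpoly k[N]}) (F : 'I_N -> _) :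
  (forall v, regular (F v)) -> regular (fun A h => poly_eval p (F^~ A ^~ h)).
Proof.
move=> Fr; apply: regular_sum => m; apply: regularM.
  exact: regular_const.
by apply: regular_prod => v; apply: regularX.
Qed.

Lemma regular_evalf p : regular (fun A h => evalf p h).
Proof. by exists p. Qed.

Lemma regular_det d (L : forall A : kalg k, (C -> A) -> 'M[A]_d) :
  (forall i j, regular (fun A h => L A h i j)) ->
  regular (fun A h => \det (L A h)).
Proof.
move=> Lr; apply: regular_sum => s; apply: regularM; last first.
  by apply: regular_prod => i; exact: Lr.
have [p pE] := regular_const ((-1) ^+ s).
by exists p => A h; rewrite -pE rmorphXn rmorphN1.
Qed.

Definition vanishing (P : forall A : kalg k, (C -> A) -> Prop) p : Prop :=
  forall A h, P A h -> evalf p h = 0.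

(* P is cut out by the polynomials that vanish on it, over all algebras. *)
Definition zclosed (P : forall A : kalg k, (C -> A) -> Prop) : Prop :=
  forall A h, (forall p, vanishing P p -> evalf p h = 0) -> P A h.

Lemma zclosed_eq F G : regular F -> regular G ->
  zclosed (fun A h => F A h = G A h).
Proof.
move=> [p pE] [q qE] A h /(_ (p - q)).
rewrite evalfB => H; rewrite pE qE; apply/eqP; rewrite -subr_eq0.
apply/eqP; apply: H => B g.
by rewrite pE qE evalfB => ->; rewrite subrr.
Qed.

Lemma zclosed_forall (I : Type) (P : I -> _) :
  (forall i, zclosed (P i)) -> zclosed (fun A h => forall i, P i A h).
Proof.
move=> Pc A h H i; apply: Pc => p pP; apply: H => B g Pg; exact: pP.
Qed.

Lemma zclosed_imply (Q : Prop) P :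
  zclosed P -> zclosed (fun A h => Q -> P A h).
Proof. by move=> Pc; apply: (@zclosed_forall Q (fun=> P)). Qed.

Lemma zclosed_and P Q :
  zclosed P -> zclosed Q -> zclosed (fun A h => P A h /\ Q A h).
Proof.
move=> Pc Qc A h H; split; [apply: Pc|apply: Qc] => p pP; apply: H => B g [].
  by move=> Pg _; exact: pP.
by move=> _ Pg; exact: pP.
Qed.

Lemma zclosed_mx m n (L P : forall A : kalg k, (C -> A) -> 'M[A]_(m, n)) :
  (forall i j, regular (fun A h => L A h i j)) ->
  (forall i j, regular (fun A h => P A h i j)) ->
  zclosed (fun A h => L A h = P A h).
Proof.
move=> Lr Pr A h H; apply/matrixP => i j.
apply: (zclosed_eq (Lr i j) (Pr i j)) => p pP; apply: H => B g LP.
by apply: pP; rewrite LP.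
Qed.

(** * The coordinate ring of a zero locus *)

Section Locus.
Variables (P : forall A : kalg k, (C -> A) -> Prop) (Pc : zclosed P).

Lemma zclosed_fmap A B (f : khom A B) h : P h -> P (f \o h).
Proof.
by move=> Ph; apply: Pc => p pP; rewrite evalf_fmap (pP _ _ Ph) rmorph0.
Qed.

Program Definition zero_locus : kfunctor k :=
  @KFunctor k (fun A => {h : C -> A | P h})
    (fun A B f h => exist _ (f \o sval h) (zclosed_fmap f (svalP h))) _ _.
Next Obligation.
by move=> A f h e; apply: sig_eq; apply: funext => c /=; rewrite e.
Qed.
Next Obligation.
by move=> A B D f g h x e; apply: sig_eq; apply: funext => c /=; rewrite e.
Qed.

Definition locus_ideal : {pred {mpoly k[#|C|]}} :=
  fun p => `[< vanishing P p >].

Lemma locus_ideal_zmod : zmod_closed locus_ideal.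
Proof.
split=> [|p q /asboolP pP /asboolP qP]; apply/asboolP => A h Ph.
  exact: poly_eval0.
by rewrite evalfB pP // qP // subrr.
Qed.

HB.instance Definition _ :=
  GRing.isZmodClosed.Build _ locus_ideal locus_ideal_zmod.

Local Open Scope quotient_scope.

(** An additive quotient, multiplied below through representatives, so that the zero ring of an
    empty locus is included. *)
Definition coord_ring : Type := Quotient.quot locus_ideal.
HB.instance Definition _ := GRing.Zmodule.on coord_ring.

Definition coord_class (p : {mpoly k[#|C|]}) : coord_ring :=
  \pi_(Quotient.quot locus_ideal) p.

Lemma coord_classP p q :
  coord_class p = coord_class q <-> vanishing P (p - q).
Proof.
rewrite /coord_class; split=> [/eqP|H]; last apply/eqP.
  by rewrite -Quotient.idealrBE => /asboolP.
by rewrite -Quotient.idealrBE; apply/asboolP.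
Qed.

Definition coord_repr (x : coord_ring) : {mpoly k[#|C|]} := repr x.

Lemma coord_reprK : cancel coord_repr coord_class.
Proof. exact: reprK. Qed.

Lemma coord_classD p q : coord_class (p + q) = coord_class p + coord_class q.
Proof. by rewrite /coord_class raddfD. Qed.

Definition coord_mul x y := coord_class (coord_repr x * coord_repr y).

(** Membership in the ideal is tested on the points of [P], where a representative takes the same
    values as the polynomial it represents. *)
Lemma coord_mulE p q :
  coord_mul (coord_class p) (coord_class q) = coord_class (p * q).
Proof.
apply/coord_classP => A h Ph.
have E r : evalf (coord_repr (coord_class r)) h = evalf r h.
  have /coord_classP/(_ A h Ph) := coord_reprK (coord_class r).
  by rewrite evalfB => /eqP; rewrite subr_eq0 => /eqP.
by rewrite evalfB !evalfM !E subrr.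
Qed.

Lemma coord_mulA : associative coord_mul.
Proof.
move=> x y z; rewrite -(coord_reprK x) -(coord_reprK y) -(coord_reprK z).
by rewrite !coord_mulE mulrA.
Qed.

Lemma coord_mulC : commutative coord_mul.
Proof. by move=> x y; rewrite /coord_mul mulrC. Qed.

Lemma coord_mul1 : left_id (coord_class 1) coord_mul.
Proof. by move=> x; rewrite -(coord_reprK x) coord_mulE mul1r. Qed.

Lemma coord_mulDl : left_distributive coord_mul +%R.
Proof.
move=> x y z; rewrite -(coord_reprK x) -(coord_reprK y) -(coord_reprK z).
by rewrite -coord_classD !coord_mulE mulrDl coord_classD.
Qed.

HB.instance Definition _ := GRing.Zmodule_isComPzRing.Build coord_ring
  coord_mulA coord_mulC coord_mul1 coord_mulDl.

Lemma coord_class_zmod : zmod_morphism coord_class.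
Proof. by move=> p q; rewrite /coord_class raddfB. Qed.

Lemma coord_class_monoid : monoid_morphism coord_class.
Proof. by split=> // p q; rewrite -coord_mulE. Qed.

HB.instance Definition _ :=
  GRing.isZmodMorphism.Build _ _ coord_class coord_class_zmod.
HB.instance Definition _ :=
  GRing.isMonoidMorphism.Build _ _ coord_class coord_class_monoid.

Definition coord_alg : kalg k :=
  @KAlg k coord_ring (coord_class \o @mpolyC _ k).

Definition generic_coord (c : C) : coord_alg := coord_class 'X_(enum_rank c).

Lemma evalf_generic p : evalf p generic_coord = coord_class p.
Proof.
rewrite [in RHS](mpolyE p) rmorph_sum; apply: eq_bigr => m _.
rewrite -mul_mpolyC rmorphM /=; congr (_ * _).
rewrite mpolyXE_id rmorph_prod; apply: eq_bigr => v _.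
by rewrite rmorphXn /generic_coord enum_valK.
Qed.

(** A polynomial vanishing on [P] evaluates at the tautological point to its own class, which is
    zero; closedness then puts this point in [P]. *)
Lemma generic_coordP : P generic_coord.
Proof.
apply: Pc => p pP; rewrite evalf_generic -(rmorph0 coord_class).
by apply/coord_classP; rewrite subr0.
Qed.

Section Evaluation.
Variables (A : kalg k) (h : zero_locus A).

Definition locus_eval (x : coord_ring) : A := evalf (coord_repr x) (sval h).

Lemma locus_eval_class p : locus_eval (coord_class p) = evalf p (sval h).
Proof.
have /coord_classP/(_ A _ (svalP h)) := coord_reprK (coord_class p).
by rewrite evalfB => /eqP; rewrite subr_eq0 => /eqP.
Qed.

Lemma locus_eval_zmod : zmod_morphism locus_eval.
Proof.
move=> x y; rewrite -(coord_reprK x) -(coord_reprK y) -rmorphB.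
by rewrite !locus_eval_class evalfB.
Qed.

Lemma locus_eval_monoid : monoid_morphism locus_eval.
Proof.
split=> [|x y].
  by rewrite -(rmorph1 coord_class) locus_eval_class evalf1.
rewrite -(coord_reprK x) -(coord_reprK y) -rmorphM.
by rewrite !locus_eval_class evalfM.
Qed.

HB.instance Definition _ :=
  GRing.isZmodMorphism.Build _ _ locus_eval locus_eval_zmod.
HB.instance Definition _ :=
  GRing.isMonoidMorphism.Build _ _ locus_eval locus_eval_monoid.

Lemma locus_eval_str c : locus_eval (kalg_str coord_alg c) = kalg_str A c.
Proof. by rewrite locus_eval_class /evalf poly_evalC. Qed.

Definition locus_khom : khom coord_alg A :=
  @KHom k coord_alg A locus_eval locus_eval_str.

End Evaluation.

Program Definition locus_to_spec : kmor zero_locus (Spec coord_alg) :=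
  @KMor k zero_locus (Spec coord_alg) locus_khom _.
Next Obligation.
move=> A B f h; apply: khom_eq => x; rewrite /= -(coord_reprK x).
by rewrite !locus_eval_class evalf_fmap.
Qed.

Program Definition spec_to_locus : kmor (Spec coord_alg) zero_locus :=
  @KMor k (Spec coord_alg) zero_locus
    (fun A u => exist _ (u \o generic_coord) (zclosed_fmap u generic_coordP)) _.
Next Obligation. by move=> A B f u; apply: sig_eq. Qed.

Lemma zero_locus_affine : is_affine zero_locus.
Proof.
exists coord_alg, locus_to_spec, spec_to_locus; split=> [A h|A u].
  apply: sig_eq; apply: funext => c; rewrite /= locus_eval_class.
  by rewrite /evalf poly_evalX enum_rankK.
apply: khom_eq => x; rewrite /= -(coord_reprK x) locus_eval_class.
by rewrite evalf_fmap evalf_generic.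
Qed.

End Locus.
End ZeroLocus.

(** * Coordinates on the thin Schubert cell *)

Section RowSpaces.
Variables (A : comPzRingType) (n : nat).

Lemma colsub_mulmx m p q (g : 'M[A]_(m, p)) (L : 'M[A]_(p, n))
    (e : 'I_q -> 'I_n) :
  colsub e (g *m L) = g *m colsub e L.
Proof.
by apply/matrixP => i j; rewrite !mxE; apply: eq_bigr => l _; rewrite mxE.
Qed.

Lemma minor_mulmx d (g : 'M[A]_d) (L : 'M[A]_(d, n)) (I : dsubset n d) :
  minor (g *m L) I = \det g * minor L I.
Proof. by rewrite /minor colsub_mulmx det_mulmx. Qed.

Lemma row_space_mul m p (g : 'M[A]_(m, p)) (D : 'M[A]_(p, m))
    (L : 'M[A]_(p, n)) :
  D *m g = 1%:M -> row_space (g *m L) = row_space L.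
Proof.
move=> Dg; apply/seteqP; split; apply/row_spaceP; first by exists g.
by exists D; rewrite mulmxA Dg mul1mx.
Qed.

(** The matrix relating the two representatives can be read off on the columns [e], where it is the
    identity. *)
Lemma row_space_inj d (e : 'I_d -> 'I_n) (L L' : 'M[A]_(d, n)) :
  colsub e L = 1%:M -> colsub e L' = 1%:M -> row_space L = row_space L' ->
  L = L'.
Proof.
move=> e1 e2 eLL'.
have [U LE] : exists U, L = U *m L' by apply/row_spaceP; rewrite eLL'.
by move: e1; rewrite LE colsub_mulmx e2 mulmx1 => ->; rewrite mul1mx.
Qed.

(* uinv a = 0 if a is not a unit. *)
Definition uinv (a : A) : A := xget 0 [set b | a * b = 1].

Lemma uinv_eq a b : a * b = 1 -> uinv a = b.
Proof.
move=> ab; rewrite /uinv; case: xgetP => [c _ /= ac|/(_ b)]; last by [].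
by rewrite -[c]mulr1 -ab mulrA [c * a]mulrC ac mul1r.
Qed.

Lemma uinvP a : (exists b, a * b = 1) -> a * uinv a = 1.
Proof. by move=> [b ab]; rewrite (uinv_eq ab). Qed.

End RowSpaces.

(** * Normalized matrices as affine coordinates *)

Section CellCoordinates.
Variables (K : numFieldType) (n k : nat) (d : 'I_k -> nat).
Hypothesis d_gt0 : forall i, (0 < d i)%N.
Variable M : forall i, matroid n (d i).
Local Notation X := (thin_cell K M).

Definition is_relation (p : {mpoly K[#|plucker_index n d|]}) : Prop :=
  forall L0, is_cell_flag M L0 ->
    poly_eval (A := base_ring K) p (plucker L0) = 0.

Definition satisfies_relations (A : kalg K) (L : forall i, 'M[A]_(d i, n)) :=
  forall p, is_relation p -> poly_eval p (plucker L) = 0.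

(** Multiplying the first row of the [i]-th matrix by [s] keeps the subspaces and scales one block
    of Pluecker coordinates; [d_gt0] provides that row. *)
Lemma cell_flag_scale (L : forall i, 'M[K]_(d i, n)) (i : 'I_k) (s : K) :
  s != 0 -> is_cell_flag M L ->
  exists2 L', is_cell_flag M L' &
    plucker L' = fun v => s ^+ (tag (enum_val v) == i) * plucker L v.
Proof.
move=> s0 [LB Lflag].
pose g j : 'M[K]_(d j) :=
  if j == i then diag_mx (\row_c (if c == 0 :> nat then s else 1)) else 1%:M.
have det_g j : \det (g j) = s ^+ (j == i).
  rewrite /g; case: eqP => [_|_]; last by rewrite det1.
  rewrite det_diag (bigD1 (Ordinal (d_gt0 j))) //= mxE /= big1 ?mulr1 // => c.
  by rewrite mxE -val_eqE /= => /negbTE ->.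
have g_unit j : invmx (g j) *m g j = 1%:M.
  by rewrite mulVmx // unitmxE det_g unitfE expf_neq0.
exists (fun j => g j *m L j); last first.
  by apply: funext => v; rewrite /plucker minor_mulmx det_g.
split=> [j I|j l jl].
  rewrite -LB minor_mulmx det_g; split=> [H e|/eqP H].
    by apply: H; rewrite e mulr0.
  by apply/eqP; rewrite mulf_neq0 // expf_neq0.
by rewrite !(row_space_mul _ (g_unit _)); exact: Lflag.
Qed.

(** The relations are multihomogeneous, with one degree per subspace. A change of rows scales the
    [i]-th block by [\det (g i)], and [poly_eval_scale] handles the blocks one at a time. *)
Lemma satisfies_relations_mul (A : kalg K) (L : forall i, 'M[A]_(d i, n))
    (g : forall i, 'M[A]_(d i)) :
  satisfies_relations L -> satisfies_relations (fun i => g i *m L i).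
Proof.
move=> Lrel.
pose S : set ('I_#|plucker_index n d| -> K) :=
  [set q | exists2 L0, is_cell_flag M L0 & q = plucker L0].
pose c (i : 'I_k) (v : 'I_#|plucker_index n d|) : nat := tag (enum_val v) == i.
have Sscale i (q : _ -> K) (s : K) : s != 0 -> S q ->
    S (fun v => s ^+ c i v * q v).
  move=> s0 [L0 L0P ->].
  by have [L' L'P <-] := cell_flag_scale i s0 L0P; exists L'.
suff good (r : seq 'I_k) p :
    (forall q, S q -> poly_eval (A := base_ring K) p q = 0) ->
    poly_eval p
      (fun v => (\prod_(i <- r) \det (g i) ^+ c i v) * plucker L v) = 0.
  move=> p pP.
  have -> : plucker (fun i => g i *m L i) =
      fun v => (\prod_(i <- enum 'I_k) \det (g i) ^+ c i v) * plucker L v.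
    apply: funext => v; rewrite /plucker minor_mulmx big_enum /=; congr (_ * _).
    rewrite (bigD1 (tag (enum_val v))) //= /c eqxx expr1 big1 ?mulr1 // => i.
    by rewrite eq_sym => /negbTE ->.
  by apply: good => _ [L0 L0P ->]; exact: pP.
elim: r p => [|i r IH] p pP.
  under eq_fun do rewrite big_nil mul1r.
  by apply: Lrel => L0 L0P; apply: pP; exists L0.
under eq_fun do rewrite big_cons -mulrA.
exact: (poly_eval_scale _ (Sscale i) IH pP).
Qed.

Lemma dbasis_exists i : exists I : dsubset n (d i), val I \in bases (M i).
Proof.
have [I IB] := bases_neq0 (M i).
have Id : #|I| == d i by apply/eqP; exact: bases_card IB.
by exists (exist _ I Id).
Qed.

Definition dbasis i : dsubset n (d i) := sval (cid (dbasis_exists i)).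

Lemma dbasisP i : val (dbasis i) \in bases (M i).
Proof. exact: svalP (cid (dbasis_exists i)). Qed.

Definition dbasis_col i : 'I_(d i) -> 'I_n := dsubset_nth (dbasis i).

Lemma cell_flag_mx_exists (A : kalg K) (x : X A) :
  exists L : forall i, 'M[A]_(d i, n),
    [/\ forall i, sval x i = row_space (L i),
        forall i, colsub (@dbasis_col i) (L i) = 1%:M,
        forall i (I : dsubset n (d i)),
          if val I \in bases (M i) then exists y, minor (L i) I * y = 1
          else minor (L i) I = 0
      & satisfies_relations L].
Proof.
case: x => W [L [WL Wflag Lunit Lrel]] /=.
pose C i := colsub (@dbasis_col i) (L i).
have /choice[y yE] : forall i, exists y, \det (C i) * y = 1.
  move=> i; by have := Lunit i (dbasis i); rewrite dbasisP.
(* The inverse of the block of basis columns, with [y i] the inverse of its determinant. *)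
pose g i := y i *: \adj (C i).
have Cg i : C i *m g i = 1%:M.
  by rewrite -scalemxAr mul_mx_adj -[LHS]mul_scalar_mx -scalar_mxM mulrC yE.
have gC i : g i *m C i = 1%:M.
  by rewrite -scalemxAl mul_adj_mx -[LHS]mul_scalar_mx -scalar_mxM mulrC yE.
exists (fun i => g i *m L i); split.
- by move=> i; rewrite WL (row_space_mul _ (Cg i)).
- by move=> i; rewrite colsub_mulmx gC.
- move=> i I; have := Lunit i I; rewrite minor_mulmx.
  case: ifP => _ => [[z zE]|->]; last by rewrite mulr0.
  exists (\det (C i) * z).
  by rewrite mulrACA zE mulr1 -det_mulmx gC det1.
- exact: satisfies_relations_mul.
Qed.

(* The representative of the i-th subspace whose columns in dbasis i form     *)
(* the identity matrix.                                                       *)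
Definition cell_mx (A : kalg K) (x : X A) : forall i, 'M[A]_(d i, n) :=
  sval (cid (cell_flag_mx_exists x)).

Lemma cell_mxP (A : kalg K) (x : X A) (L := cell_mx x) :
    [/\ forall i, sval x i = row_space (L i),
        forall i, colsub (@dbasis_col i) (L i) = 1%:M,
        forall i (I : dsubset n (d i)),
          if val I \in bases (M i) then exists y, minor (L i) I * y = 1
          else minor (L i) I = 0
      & satisfies_relations L].
Proof. exact: svalP (cid (cell_flag_mx_exists x)). Qed.

Lemma cell_mx_eq (A : kalg K) (x : X A) (L : forall i, 'M[A]_(d i, n)) i :
  sval x i = row_space (L i) -> colsub (@dbasis_col i) (L i) = 1%:M ->
  cell_mx x i = L i.
Proof.
have [xE x1 _ _] := cell_mxP x; rewrite xE => e e1.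
exact: row_space_inj (x1 i) e1 e.
Qed.

Lemma cell_mx_fmap (A B : kalg K) (f : khom A B) (x : X A) i :
  cell_mx (fmap f x) i = map_mx f (cell_mx x i).
Proof.
have [xE x1 _ _] := cell_mxP x.
apply: (@cell_mx_eq _ (fmap f x) (fun i => map_mx f (cell_mx x i))).
  by rewrite /= xE extend_row_space.
have -> : colsub (@dbasis_col i) (map_mx f (cell_mx x i)) =
    map_mx f (colsub (@dbasis_col i) (cell_mx x i)).
  by apply/matrixP => r c; rewrite !mxE.
by rewrite x1 map_mx1.
Qed.

(** The second summand holds inverses of minors, which turn the open condition at the bases into
    equations. Its slots at non-bases are set to 0 by [cell_equations], so that a point determines
    all its coordinates. *)
Definition cell_coord : finType :=
  {i : 'I_k & ('I_(d i) * 'I_n + dsubset n (d i))%type}.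

Definition entry_coord i (r : 'I_(d i)) (j : 'I_n) : cell_coord :=
  existT _ i (inl (r, j)).

Definition inv_coord i (I : dsubset n (d i)) : cell_coord := existT _ i (inr I).

Definition coord_mx (A : kalg K) (h : cell_coord -> A) i : 'M[A]_(d i, n) :=
  \matrix_(r, j) h (entry_coord r j).

(** The second clause is inclusion of subspaces as an equation: the identity block of the [j]-th
    matrix forces the coefficients of the rows of the [i]-th to be their entries in the columns
    [dbasis_col j]. *)
Definition cell_equations (A : kalg K) (h : cell_coord -> A) : Prop :=
  (forall i, colsub (@dbasis_col i) (coord_mx h i) = 1%:M) /\
  (forall i j : 'I_k, (i <= j)%N ->
     coord_mx h i = colsub (@dbasis_col j) (coord_mx h i) *m coord_mx h j) /\
  (forall i I, val I \in bases (M i) ->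
     minor (coord_mx h i) I * h (inv_coord I) = 1) /\
  (forall i I, val I \notin bases (M i) ->
     minor (coord_mx h i) I = 0 /\ h (inv_coord I) = 0) /\
  (forall p, is_relation p -> poly_eval p (plucker (coord_mx h)) = 0).

Lemma regular_coord_mx i r j :
  regular (fun (A : kalg K) (h : cell_coord -> A) => coord_mx h i r j).
Proof.
have [p pE] := regular_coord K (entry_coord r j).
by exists p => A h; rewrite mxE.
Qed.

Lemma regular_minor i I :
  regular (fun (A : kalg K) (h : cell_coord -> A) => minor (coord_mx h i) I).
Proof.
apply: regular_det => r c.
have [p pE] := regular_coord_mx r (dsubset_nth I c).
by exists p => A h; rewrite -pE [LHS]mxE.
Qed.

Lemma zclosed_cell_equations : zclosed cell_equations.
Proof.
have colr i j (e : 'I_j -> 'I_n) r c : regular (fun (A : kalg K)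
    (h : cell_coord -> A) => colsub e (coord_mx h i) r c).
  have [p pE] := regular_coord_mx r (e c).
  by exists p => A h; rewrite -pE [LHS]mxE.
apply: zclosed_and; last apply: zclosed_and; last apply: zclosed_and;
  last apply: zclosed_and.
- apply: zclosed_forall => i; apply: zclosed_mx; first exact: colr.
  move=> r c; have [p pE] := regular_const cell_coord ((r == c)%:R : K).
  by exists p => A h; rewrite -pE !mxE rmorph_nat.
- apply: zclosed_forall => i; apply: zclosed_forall => j.
  apply: zclosed_imply; apply: zclosed_mx => r c; first exact: regular_coord_mx.
  have [|p pE] := @regular_sum _ _ _ (index_enum 'I_(d j)) (fun l A h =>
    colsub (@dbasis_col j) (coord_mx h i) r l * coord_mx h j l c).
    by move=> l; apply: regularM; [exact: colr|exact: regular_coord_mx].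
  by exists p => A h; rewrite -pE mxE.
- apply: zclosed_forall => i; apply: zclosed_forall => I; apply: zclosed_imply.
  apply: zclosed_eq; last exact: regular1.
  by apply: regularM; [exact: regular_minor|exact: regular_coord].
- apply: zclosed_forall => i; apply: zclosed_forall => I; apply: zclosed_imply.
  apply: zclosed_and; (apply: zclosed_eq; last exact: regular0).
    exact: regular_minor.
  exact: regular_coord.
- apply: zclosed_forall => p; apply: zclosed_imply.
  apply: zclosed_eq; last exact: regular0.
  apply: (regular_poly_eval p (F := fun v A h => plucker (coord_mx h) v)) => v.
  exact: regular_minor.
Qed.

Definition coords (A : kalg K) (x : X A) (c : cell_coord) : A :=
  match tagged c with
  | inl rj => cell_mx x (tag c) rj.1 rj.2
  | inr J => if val J \in bases (M (tag c))
             then uinv (minor (cell_mx x (tag c)) J) else 0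
  end.

Lemma coord_mx_coords (A : kalg K) (x : X A) i :
  coord_mx (coords x) i = cell_mx x i.
Proof. by apply/matrixP => r j; rewrite mxE. Qed.

Lemma cell_equations_coords (A : kalg K) (x : X A) : cell_equations (coords x).
Proof.
have [xE x1 xu xrel] := cell_mxP x.
have cE : coord_mx (coords x) = cell_mx x.
  by apply: functional_extensionality_dep => i; exact: coord_mx_coords.
rewrite /cell_equations cE; split=> //; split; last split; last split=> //.
- move=> i j ij; have [L [_ Lflag _ _]] := svalP x.
  have /row_spaceP[U ->] : row_space (cell_mx x i) `<=` row_space (cell_mx x j).
    by rewrite -!xE; exact: Lflag.
  by rewrite colsub_mulmx x1 mulmx1.
- move=> i I IB; rewrite /coords /= IB; apply: uinvP.
  by have := xu i I; rewrite IB.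
- by move=> i I IB; have := xu i I; rewrite /coords /= (negbTE IB).
Qed.

Lemma coords_fmap (A B : kalg K) (f : khom A B) (x : X A) :
  coords (fmap f x) = f \o coords x.
Proof.
apply: funext => -[i [[r j]|I]]; rewrite /coords /= cell_mx_fmap ?mxE //.
case: ifP => IB; last by rewrite rmorph0.
apply: uinv_eq; rewrite map_minor -rmorphM uinvP ?rmorph1 //.
by have [_ _ /(_ i I)] := cell_mxP x; rewrite IB.
Qed.

Lemma cell_point_of_coords (A : kalg K) (h : cell_coord -> A) :
  cell_equations h -> is_cell_point M (fun i => row_space (coord_mx h i)).
Proof.
move=> [h1 [hflag [hu [h0 hrel]]]]; exists (coord_mx h); split=> //.
- by move=> i j ij; apply/row_spaceP; eexists; exact: hflag.
- move=> i I; case: ifPn => IB; last by have [] := h0 i I IB.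
  by exists (h (inv_coord I)); exact: hu.
Qed.

Definition cell_of (A : kalg K) (h : cell_coord -> A) (hP : cell_equations h) :
  X A := exist _ _ (cell_point_of_coords hP).

Lemma coords_inj (A : kalg K) (x y : X A) : coords x = coords y -> x = y.
Proof.
move=> e; apply: sig_eq; apply: functional_extensionality_dep => i.
have [-> _ _ _] := cell_mxP x; have [-> _ _ _] := cell_mxP y.
by rewrite -!coord_mx_coords e.
Qed.

Lemma cell_ofK (A : kalg K) (h : cell_coord -> A) (hP : cell_equations h) :
  coords (cell_of hP) = h.
Proof.
have [h1 [_ [hu [h0 _]]]] := hP.
have cE i : cell_mx (cell_of hP) i = coord_mx h i by exact: cell_mx_eq.
apply: funext => -[i [[r j]|I]]; rewrite /coords /= cE; first by rewrite mxE.
case: ifPn => IB; first by apply: uinv_eq; exact: hu.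
by have [] := h0 i I IB.
Qed.

End CellCoordinates.

(** * An equivariant map to the torus *)

Section DSubsets.
Variables (n d : nat) (I : dsubset n d).

Lemma dsubset_nth_in c : dsubset_nth I c \in val I.
Proof. exact: enum_valP. Qed.

Lemma dsubset_nth_inj : injective (dsubset_nth I).
Proof. by move=> c c' /enum_val_inj /cast_ord_inj. Qed.

Lemma dsubset_nth_surj j : j \in val I -> exists c, dsubset_nth I c = j.
Proof.
move=> jI; exists (cast_ord (eqP (valP I)) (enum_rank_in jI j)).
by rewrite /dsubset_nth cast_ordK enum_rankK_in.
Qed.

(** [minor] takes columns in increasing order, while exchanging one column in place breaks that
    order; sorting costs a sign. *)
Lemma minor_perm (A : comPzRingType) (L : 'M[A]_(d, n)) (f : 'I_d -> 'I_n) :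
  injective f -> (forall c, f c \in val I) ->
  exists s : bool, \det (colsub f L) = (-1) ^+ s * minor L I.
Proof.
move=> f_inj fI.
have /choice[g gE] c := dsubset_nth_surj (fI c).
have g_inj : injective g by move=> c c' e; apply: f_inj; rewrite -!gE e.
exists (odd_perm (perm g_inj)).
have -> : colsub f L = colsub (dsubset_nth I) L *m (perm_mx (perm g_inj))^T.
  rewrite tr_perm_mx -col_permE; apply/matrixP => i j.
  by rewrite !mxE permE gE.
by rewrite det_mulmx det_tr det_perm mulrC.
Qed.

End DSubsets.

(** In row [r] only the exchanged column can contribute, and its cofactor is the determinant of an
    identity matrix. *)
Lemma det_exchange (A : comPzRingType) (n d : nat) (L : 'M[A]_(d, n))
    (e : 'I_d -> 'I_n) (r : 'I_d) (j : 'I_n) :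
  colsub e L = 1%:M ->
  \det (colsub (fun c => if c == r then j else e c) L) = L r j.
Proof.
move=> e1.
have Le i c : L i (e c) = (i == c)%:R.
  by have /matrixP/(_ i c) := e1; rewrite !mxE.
rewrite (expand_det_row _ r) (bigD1 r) //= mxE eqxx big1 => [|c /negbTE cr].
  rewrite addr0 /cofactor addnn -mul2n exprM sqrrN expr1n expr1n mul1r.
  set D := row' _ _; suff -> : D = 1%:M by rewrite det1 mulr1.
  apply/matrixP => a b; rewrite !mxE eq_sym (negbTE (neq_lift r b)) Le.
  by rewrite (inj_eq lift_inj).
by rewrite mxE cr Le eq_sym cr mul0r.
Qed.

(** * Weights of units under the torus *)

Section Weights.
Variables (K : numFieldType) (n k : nat) (d : 'I_k -> nat).
Hypothesis d_gt0 : forall i, (0 < d i)%N.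
Variable M : forall i, matroid n (d i).
Local Notation X := (thin_cell K M).
Local Notation T := (torus K n).
Local Notation cell_mx := (cell_mx d_gt0).
Local Notation coords := (coords d_gt0).
Local Notation "x ** t" := (torus_action K M _ x t) (at level 40).

Lemma torus_mulV (A : kalg K) (t : T A) j :
  sval (ginv t) 0 j * sval t 0 j = 1.
Proof.
by have /(congr1 (fun u : T A => sval u 0 j)) := gmulVg t; rewrite /= !mxE.
Qed.

Lemma torus_mulE (A : kalg K) (t u : T A) j :
  sval (gmul t u) 0 j = sval t 0 j * sval u 0 j.
Proof. by rewrite mxE. Qed.

(** Acting by [t] turns the identity block into a diagonal one, which the left factor undoes. *)
Lemma cell_mx_act (A : kalg K) (x : X A) (t : T A) i :
  cell_mx (x ** t) i =
  diag_mx (\row_c sval (ginv t) 0 (dbasis_col M c)) *m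
    (cell_mx x i *m diag_mx (sval t)).
Proof.
have [xE x1 _ _] := cell_mxP d_gt0 x; have tV := torus_mulV t.
move: (sval (ginv t)) tV => u tV.
apply: (@cell_mx_eq _ _ _ _ d_gt0 M A (x ** t) (fun i =>
  diag_mx (\row_c u 0 (dbasis_col M c)) *m
    (cell_mx x i *m diag_mx (sval t)))); last first.
  rewrite -[RHS](x1 i) colsub_mulmx; apply/matrixP => r c.
  have /matrixP/(_ r c) := x1 i.
  rewrite mul_diag_mx mul_mx_diag !mxE => ->.
  case: eqP => [->|_]; last by rewrite mul0r mulr0.
  by rewrite mul1r tV.
rewrite (@row_space_mul _ _ _ _ _
  (diag_mx (\row_c sval t 0 (dbasis_col M c)))); last first.
  rewrite mulmx_diag; apply/matrixP => r c; rewrite !mxE.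
  by rewrite [_ * u _ _]mulrC tV.
by rewrite /= xE row_space_mulr.
Qed.

Definition dweight (A : kalg K) (t : T A) (I : {set 'I_n}) : A :=
  \prod_(j < n) sval t 0 j ^+ (j \in I).

Lemma dweightD1 (A : kalg K) (t : T A) (I : {set 'I_n}) i : i \notin I ->
  dweight t (i |: I) = sval t 0 i * dweight t I.
Proof.
move=> iI; rewrite /dweight (bigD1 i) //= setU11 expr1; congr (_ * _).
rewrite [RHS](bigD1 i) //= (negbTE iI) expr0 mul1r.
by apply: eq_bigr => j ji; rewrite in_setU1 (negbTE ji).
Qed.

(** The inverse of the weight of the fixed basis: the determinant of the renormalizing factor in
    [cell_mx_act]. *)
Definition basis_weight (A : kalg K) (t : T A) i : A :=
  \prod_c sval (ginv t) 0 (@dbasis_col _ _ _ M i c).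

Lemma minor_act (A : kalg K) (x : X A) (t : T A) i I :
  minor (cell_mx (x ** t) i) I =
  basis_weight t i * dweight t (val I) * minor (cell_mx x i) I.
Proof.
rewrite cell_mx_act minor_mulmx minor_diag det_diag mulrA; congr (_ * _ * _).
by apply: eq_bigr => c _; rewrite mxE.
Qed.

Lemma inv_coordP (A : kalg K) (x : X A) i (I : dsubset n (d i)) :
  val I \in bases (M i) ->
  minor (cell_mx x i) I * coords x (inv_coord I) = 1.
Proof.
move=> IB; have [_ [_ [/(_ i I IB)]]] := cell_equations_coords d_gt0 x.
by rewrite coord_mx_coords.
Qed.

Lemma inv_coord_act (A : kalg K) (x : X A) (t : T A) i (I : dsubset n (d i)) :
  val I \in bases (M i) ->
  basis_weight t i * dweight t (val I) * coords (x ** t) (inv_coord I) =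
  coords x (inv_coord I).
Proof.
move=> IB; have := inv_coordP (x ** t) IB; rewrite minor_act.
set b := _ * dweight _ _ => e.
by rewrite -[RHS]mul1r -e [b * _ * _]mulrAC -[RHS]mulrA inv_coordP // mulr1.
Qed.

(* The cell carries a unit of weight t_j / t_i. *)
Definition linked (i j : 'I_n) : Prop :=
  exists q q' : {mpoly K[#|cell_coord n d|]}, forall (A : kalg K) (x : X A),
    evalf q (coords x) * evalf q' (coords x) = 1 /\
    forall t : T A, evalf q (coords (x ** t)) * sval t 0 i =
      sval t 0 j * evalf q (coords x).

Lemma linked_refl i : linked i i.
Proof.
exists 1, 1 => A x; rewrite !evalf1 mulr1; split=> // t.
by rewrite evalf1 mulr1 mul1r.
Qed.

(** The inverse unit has the inverse weight. *)
Lemma linked_sym i j : linked i j -> linked j i.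
Proof.
move=> [q [q' qP]]; exists q', q => A x; have [+ qact] := qP A x.
move: (evalf q' (coords x)) => a' qa'; split=> [|t]; first by rewrite mulrC.
have [+ _] := qP A (x ** t); move: (qact t) qa'; move: (evalf q (coords x)).
move: (evalf q _) (evalf q' _) (sval t 0 i) (sval t 0 j).
move=> b b' u v a ab aa' bb'.
by rewrite -[b' * v]mulr1 -aa' -mulrA [v * _]mulrA -ab !mulrA [b' * b]mulrC bb'
  mul1r.
Qed.

Lemma linked_trans i j l : linked i j -> linked j l -> linked i l.
Proof.
move=> [p [p' pP]] [q [q' qP]]; exists (p * q), (p' * q') => A x.
have [+ pact] := pP A x; have [+ qact] := qP A x; rewrite !evalfM.
move: (evalf p' _) (evalf q' _) => a' b' bb' aa'; split=> [|t].
  by rewrite mulrACA aa' bb' mulr1.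
rewrite !evalfM; move: (pact t) (qact t).
move: (evalf p (coords x)) (evalf q (coords x)) => a b.
move: (evalf p _) (evalf q _) => u v ua vb.
by rewrite mulrAC ua mulrAC [_ * v]mulrC vb -mulrA [b * _]mulrC.
Qed.

(** The unit is [p_J / p_I]: the factor [basis_weight] cancels in the quotient, and so does the
    weight of the common part of [I] and [J]. *)
Lemma linked_exchange m (I J : dsubset n (d m)) i j :
  val I \in bases (M m) -> val J \in bases (M m) -> i \in val I ->
  j \notin val I -> val J = j |: (val I :\ i) -> linked i j.
Proof.
move=> IB JB iI jI JE.
have minor_inv (P Q : dsubset n (d m)) : exists q,
    forall (A : kalg K) (x : X A),
    evalf q (coords x) = minor (cell_mx x m) P * coords x (inv_coord Q).
  have [|q qE] := @regularM K _ (fun A h => minor (coord_mx h m) P)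
    (fun A h => h (inv_coord Q)) (regular_minor K P).
    exact: regular_coord.
  by exists q => A x; have := qE A (coords x); rewrite coord_mx_coords => <-.
have [q qE] := minor_inv J I; have [q' q'E] := minor_inv I J.
exists q, q' => A x; rewrite !qE q'E; split=> [|t].
  rewrite [minor _ I * _]mulrC mulrACA inv_coordP // mul1r mulrC.
  exact: inv_coordP.
rewrite qE minor_act JE dweightD1; last by rewrite !inE negb_and jI orbT.
rewrite -[in RHS](inv_coord_act x t IB).
have {2}-> : val I = i |: (val I :\ i) by rewrite finset.setD1K.
rewrite dweightD1; last by rewrite !inE eqxx.
set b := basis_weight _ _; set w := dweight _ _; set m' := minor _ _.
set c := coords _ _; set u := sval t 0 i; set v := sval t 0 j.
have -> : b * (v * w) * m' * c * u = v * (m' * (b * (u * w) * c)) by ring.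
by [].
Qed.

(** For [j] in the fixed basis the identity block decides. Otherwise the entry is, up to sign, the
    minor of the exchanged set [J], which either is a basis or has vanishing minor. *)
Lemma linked_entry (A : kalg K) (x : X A) i (r : 'I_(d i)) (j : 'I_n) :
  linked (dbasis_col M r) j \/ cell_mx x i r j = 0.
Proof.
have [_ x1 xu _] := cell_mxP d_gt0 x.
have [->|jr] := eqVneq j (dbasis_col M r); first by left; exact: linked_refl.
have colB c : @dbasis_col _ _ _ M i c \in val (dbasis M i).
  exact: dsubset_nth_in.
have [jB|jB] := boolP (j \in val (dbasis M i)).
  right; have [c cE] := dsubset_nth_surj jB; rewrite -cE in jr *.
  have /matrixP/(_ r c) := x1 i; rewrite !mxE => ->.
  by case: eqP => // rc; case/eqP: jr; rewrite rc.
pose J := j |: (val (dbasis M i) :\ dbasis_col M r).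
have JE : #|J| == d i.
  have : #|val (dbasis M i)| == d i := valP (dbasis M i).
  rewrite (cardsD1 (dbasis_col M r) (val (dbasis M i))) colB.
  by rewrite cardsU1 !inE negb_and jB orbT.
pose J' : dsubset n (d i) := exist _ J JE.
have [JB|JB] := boolP (J \in bases (M i)).
  left; apply: (@linked_exchange i (dbasis M i) J') => //; exact: dbasisP.
right; rewrite -(det_exchange r j (x1 i)).
have [c c' /=|c /=|s ->] := @minor_perm n (d i) J' _ (cell_mx x i)
  (fun c => if c == r then j else dbasis_col M c).
- case: eqP => [->|_]; case: eqP => [->|_] // e; last exact: dsubset_nth_inj e.
    by case/negP: jB; rewrite e colB.
  by case/negP: jB; rewrite -e colB.
- rewrite !inE; case: (c =P r) => [_|/eqP cr]; first by rewrite eqxx.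
  by rewrite (inj_eq (@dsubset_nth_inj _ _ _)) cr colB orbT.
by have := xu i J'; rewrite (negbTE JB) => ->; rewrite mulr0.
Qed.

(** Row [r] vanishes outside the class of its basis column, so scaling the columns by [t] amounts to
    an invertible scaling of the rows. *)
Lemma act_constant (A : kalg K) (x : X A) (t : T A) :
  (forall i j, linked i j -> sval t 0 i = sval t 0 j) -> x ** t = x.
Proof.
move=> tc; have [xE _ _ _] := cell_mxP d_gt0 x.
apply: sig_eq; apply: functional_extensionality_dep => i /=.
pose D (u : 'rV[A]_n) := diag_mx (\row_c u 0 (@dbasis_col _ _ _ M i c)).
rewrite xE row_space_mulr -/(row_space _).
have -> : cell_mx x i *m diag_mx (sval t) = D (sval t) *m cell_mx x i.
  apply/matrixP => r j; rewrite mul_diag_mx mul_mx_diag !mxE.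
  have [/tc <-|->] := linked_entry x r j; first by rewrite mulrC.
  by rewrite mul0r mulr0.
apply: (@row_space_mul _ _ _ _ _ (D (sval (ginv t)))).
have tV := torus_mulV t; rewrite /D; move: (sval (ginv t)) tV => u tV.
by rewrite mulmx_diag; apply/matrixP => r c; rewrite !mxE tV.
Qed.

Definition link_repr (j : 'I_n) : 'I_n := choose (fun i => `[< linked i j >]) j.

Lemma link_reprP j : linked (link_repr j) j.
Proof.
apply/asboolP; apply: (@chooseP _ (fun i => `[< linked i j >])).
by apply/asboolP; exact: linked_refl.
Qed.

Lemma link_repr_eq i j : linked i j -> link_repr i = link_repr j.
Proof.
move=> ij; rewrite /link_repr.
have E : (fun l => `[< linked l i >]) =1 (fun l => `[< linked l j >]).
  move=> l; apply/asboolP/asboolP => [li|lj]; first exact: linked_trans li ij.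
  exact: linked_trans lj (linked_sym ij).
rewrite (eq_choose E); apply: choose_id; apply/asboolP => //.
exact: linked_refl.
Qed.

(** The constant 1 at representatives makes the denominator [t_(link_repr j)] equal to 1 when [t] is
    itself a value of [eqv] or its inverse, as in [eqv_cell_proj]. *)
Lemma equivariant_exists j : exists q : {mpoly K[#|cell_coord n d|]},
  (link_repr j = j -> q = 1) /\
  forall (A : kalg K) (x : X A), (exists y, evalf q (coords x) * y = 1) /\
    forall t : T A, evalf q (coords (x ** t)) * sval t 0 (link_repr j) =
      sval t 0 j * evalf q (coords x).
Proof.
have [->|jr] := eqVneq (link_repr j) j.
  exists 1; split=> // A x; rewrite evalf1; split=> [|t].
    by exists 1; rewrite mulr1.
  by rewrite evalf1 mulr1 mul1r.
have [q [q' qP]] := link_reprP j; exists q; split=> [/eqP|A x].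
  by rewrite (negbTE jr).
have [qq' qact] := qP A x; split=> //.
by exists (evalf q' (coords x)).
Qed.

Definition eqv_poly (j : 'I_n) : {mpoly K[#|cell_coord n d|]} :=
  sval (cid (equivariant_exists j)).

Lemma eqv_polyP j (A : kalg K) (x : X A) :
  (exists y, evalf (eqv_poly j) (coords x) * y = 1) /\
  forall t : T A,
    evalf (eqv_poly j) (coords (x ** t)) * sval t 0 (link_repr j) =
    sval t 0 j * evalf (eqv_poly j) (coords x).
Proof. by have [_] := svalP (cid (equivariant_exists j)). Qed.

(* An equivariant map from the cell to T / Stab_T, the latter being realized  *)
(* as the torus of the t with t_j = 1 for all j = link_repr j.                *)
Program Definition eqv (A : kalg K) (x : X A) : T A :=
  exist _ (\row_j evalf (eqv_poly j) (coords x)) _.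
Next Obligation. by move=> A x j /=; rewrite mxE; case: (eqv_polyP j x). Qed.

Lemma eqv_repr (A : kalg K) (x : X A) j :
  link_repr j = j -> sval (eqv x) 0 j = 1.
Proof.
move=> jr; rewrite mxE /eqv_poly.
by have [-> // _] := svalP (cid (equivariant_exists j)); rewrite evalf1.
Qed.

Lemma eqv_act (A : kalg K) (x : X A) (t : T A) j :
  sval (eqv (x ** t)) 0 j * sval t 0 (link_repr j) =
  sval t 0 j * sval (eqv x) 0 j.
Proof.
by rewrite 2!mxE; have [_ ->] := eqv_polyP j x.
Qed.

Lemma link_reprK j : link_repr (link_repr j) = link_repr j.
Proof. exact: link_repr_eq (link_reprP j). Qed.

Definition cell_proj (A : kalg K) (x : X A) : X A := x ** ginv (eqv x).

Lemma eqv_cell_proj (A : kalg K) (x : X A) j :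
  sval (eqv (cell_proj x)) 0 j = 1.
Proof.
have := eqv_act x (ginv (eqv x)) j; rewrite torus_mulV -/(cell_proj x).
move: (sval (eqv (cell_proj x)) 0 j) => a.
have := torus_mulV (eqv x) (link_repr j).
by rewrite (eqv_repr x (link_reprK j)) mulr1 => ->; rewrite mulr1.
Qed.

Lemma cell_proj_act (A : kalg K) (x : X A) (t : T A) :
  cell_proj (x ** t) = cell_proj x.
Proof.
(* [w] carries [cell_proj x] to [cell_proj (x ** t)]. By equivariance its [j]-th entry is [t] at
   [link_repr j], so it is constant on classes and acts trivially. *)
pose w := gmul (eqv x) (gmul t (ginv (eqv (x ** t)))).
have wE j : sval w 0 j = sval t 0 (link_repr j).
  have e := eqv_act x t j; have := torus_mulV (eqv (x ** t)) j.
  rewrite /w !torus_mulE; move: e.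
  move: (sval (ginv (eqv (x ** t))) 0 j) (sval (eqv (x ** t)) 0 j).
  move: (sval (eqv x) 0 j) => a u b e ub.
  by rewrite mulrA [a * _]mulrC -e mulrAC [b * u]mulrC ub mul1r.
rewrite -[RHS](@act_constant _ _ w) => [|i j ij]; last first.
  by rewrite !wE (link_repr_eq ij).
by rewrite /cell_proj /w -!actM gmulKg.
Qed.

(** * The slice [phi = 1] and the quotient map *)

Definition slice_equations (A : kalg K) (h : cell_coord n d -> A) : Prop :=
  cell_equations M h /\ forall j, evalf (eqv_poly j) h = 1.

Lemma zclosed_slice : zclosed slice_equations.
Proof.
apply: zclosed_and; first exact: zclosed_cell_equations.
apply: zclosed_forall => j; apply: zclosed_eq; last exact: regular1.
exact: regular_evalf.
Qed.

Local Notation Y := (zero_locus zclosed_slice).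

Lemma slice_equations_proj (A : kalg K) (x : X A) :
  slice_equations (coords (cell_proj x)).
Proof.
split=> [|j]; first exact: cell_equations_coords.
by have := eqv_cell_proj x j; rewrite mxE.
Qed.

Lemma eqv_fmap (A B : kalg K) (f : khom A B) (x : X A) :
  eqv (fmap f x) = fmap f (eqv x).
Proof.
by apply: sig_eq; apply/rowP => j; rewrite /= !mxE coords_fmap evalf_fmap.
Qed.

Program Definition cell_quotient : kmor X Y :=
  @KMor K X Y
    (fun A x => exist _ (coords (cell_proj x)) (slice_equations_proj x)) _.
Next Obligation.
move=> A B f x; apply: sig_eq => /=.
by rewrite -coords_fmap /cell_proj fmap_act eqv_fmap fmap_ginv.
Qed.

Program Definition cell_section : kmor Y X :=
  @KMor K Y X (fun A h => cell_of (svalP h).1) _.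
Next Obligation.
move=> A B f h; apply: (coords_inj (d_gt0 := d_gt0)).
by rewrite coords_fmap !cell_ofK.
Qed.

Lemma cell_has_slice :
  has_slice (cell_torus_action K M) cell_quotient cell_section.
Proof.
split=> [A x g|A h|A x].
- by apply: sig_eq; rewrite /= cell_proj_act.
- apply: sig_eq; rewrite /= -[RHS](cell_ofK d_gt0 (svalP h).1).
  congr coords; rewrite /cell_proj; set x := cell_of _.
  have e1 j : sval (eqv x) 0 j = 1.
    by rewrite mxE /x cell_ofK; have [_ ->] := svalP h.
  have -> : eqv x = gone T A by apply: sig_eq; apply/rowP => j; rewrite e1 mxE.
  by rewrite -(gmulg1 (ginv _)) gmulVg act1.
(* The class of [phi(x)] undoes the projection; by [act_repr] it acts as [phi(x)] itself. *)
- exists (quot_class (stab (torus_action K M)) (eqv x)).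
  have -> : cell_section A (cell_quotient A x) = cell_proj x.
    by apply: (coords_inj (d_gt0 := d_gt0)); rewrite /= cell_ofK.
  transitivity (cell_proj x ** eqv x); last exact/esym/act_repr.
  by rewrite /cell_proj -actM gmulVg act1.
Qed.

End Weights.

Theorem theorem4p1 (R : realType) (n k : nat) (d : 'I_k -> nat)
    (k_gt0 : (0 < k)%N)
    (d_bound : forall i, (0 < d i < n)%N)
    (d_incr : forall i j : 'I_k, (i < j)%N -> (d i < d j)%N)
    (M : forall i : 'I_k, matroid n (d i)) :
  exists (Y : kfunctor R[i]) (pi : kmor (thin_cell R[i] M) Y),
    [/\ is_universal_geometric_quotient (cell_torus_action R[i] M) pi,
        is_affine Y,
        is_orbit_map (cell_torus_action R[i] M) pi (base_ring R[i]),
        is_universally_submersive pi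
      & is_universal_categorical_quotient (cell_torus_action R[i] M) pi].
Proof.
have d_gt0 i : (0 < d i)%N by case/andP: (d_bound i).
have slice := @cell_has_slice R[i] n k d d_gt0 M.
have [geom subm cat] := slice_universal slice.
exists _, (cell_quotient R[i] d_gt0 M); split=> //.
- exact: zero_locus_affine.
- exact: slice_orbit_map slice _.
Qed.
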